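(* Let $\mathcal{H}$ be a reproducing kernel Hilbert space of analytic functions on an open domain $\Omega\subset\mathbb{C}^d$. Then every function $\varphi:\Omega\to\mathbb{C}$ with $\|\varphi\|_{\mathrm{Mult}(\mathcal{H}),3}<\infty$ is analytic on $\Omega$.
   Context: Let $K$ be the reproducing kernel of $\mathcal{H}$; it is a standing assumption that $K(z,z)\neq0$ for all $z\in\Omega$. A function $L:\Omega\times\Omega\to\mathbb{C}$ is $n$-point positive if for every collection $x_1,\dots,x_n$ of $n$ (not necessarily distinct) points of $\Omega$ the matrix $[L(x_i,x_j)]_{i,j=1}^n$ is positive semi-definite. The $n$-point multiplier norm of an arbitrary function $\varphi:\Omega\to\mathbb{C}$ is $$\|\varphi\|_{\mathrm{Mult}(\mathcal{H}),n}=\inf\{C\ge0: (z,w)\mapsto K(z,w)(C^2-\varphi(z)\overline{\varphi(w)})\text{ is }n\text{-point positive}\},$$ understood as $+\infty$ if no such $C$ exists. *)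

(* Defs.v *)
From HB Require Import structures.
From mathcomp Require Import all_boot all_order all_algebra.
From mathcomp Require Import finmap complex.
From mathcomp Require Import all_classical all_reals all_analysis.
From mathcomp.analysis.showcase Require Import summability.

Set Implicit Arguments.
Unset Strict Implicit.
Unset Printing Implicit Defensive.

Import Order.TTheory GRing.Theory Num.Theory.
Import numFieldNormedType.Exports.

Local Open Scope classical_set_scope.
Local Open Scope ring_scope.

(* R[i], typed as a numClosedFieldType: the standard topology and norm are
   attached to that structure, not to the bare type R[i]. *)
Definition cplx (R : realType) : numClosedFieldType := R[i].

(* C^d; its norm is the maximum of the moduli of the coordinates. *)
Notation cspace R d := 'rV[cplx R]_d.

Definition monomial (R : realType) (d : nat) (alpha : {ffun 'I_d -> nat})
    (h : cspace R d) : cplx R :=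
  \prod_(j < d) h 0 j ^+ alpha j.

(* [totally] is the filter of large finite sets of multi-indices, so the power
   series is summed unconditionally, which in C means absolutely. *)
Definition analytic_at (R : realType) (d : nat) (f : cspace R d -> cplx R)
    (a : cspace R d) : Prop :=
  exists c : {ffun 'I_d -> nat} -> cplx R,
    \forall z \near a,
      partial_sum (fun alpha => c alpha * monomial alpha (z - a)) @ totally
        --> f z.

(* Functions on Omega are represented by total functions. For open Omega this
   notion does not depend on the values taken outside Omega. *)
Definition analytic_on (R : realType) (d : nat) (Omega : set (cspace R d))
    (f : cspace R d -> cplx R) : Prop :=
  forall a, Omega a -> analytic_at f a.

(* A Hilbert space of functions on Omega: [rkhs_eval f] is the function f, and
   an element is determined by its values on Omega. A form in
   {dot _ for Num.conj} is linear in the first argument. *)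
Record rkhs (R : realType) (d : nat) (Omega : set (cspace R d)) := Rkhs {
  rkhs_space :> completeNormedModType (cplx R) ;
  rkhs_dot : {dot rkhs_space for Num.conj} ;
  rkhs_dot_norm : forall f : rkhs_space, rkhs_dot f f = `|f| ^+ 2 ;
  rkhs_eval : rkhs_space -> cspace R d -> cplx R ;
  rkhs_eval_linear : forall z, Omega z ->
    forall (a : cplx R) (f g : rkhs_space),
      rkhs_eval (a *: f + g) z = a * rkhs_eval f z + rkhs_eval g z ;
  rkhs_eval_inj : forall f g : rkhs_space,
    (forall z, Omega z -> rkhs_eval f z = rkhs_eval g z) -> f = g ;
  rkhs_eval_bounded : forall z, Omega z ->
    exists M : cplx R, forall f : rkhs_space, `|rkhs_eval f z| <= M * `|f|
}.

Definition reproducing_kernel (R : realType) (d : nat)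
    (Omega : set (cspace R d)) (H : rkhs Omega)
    (K : cspace R d -> cspace R d -> cplx R) : Prop :=
  forall w, Omega w ->
    exists k : H, (forall z, Omega z -> rkhs_eval k z = K z w) /\
                  (forall f : H, rkhs_eval f w = rkhs_dot H f k).

(* In the partial order of C, 0 <= x says that x is real and nonnegative; so
   this condition forces A to be Hermitian. *)
Definition psdmx (R : realType) (n : nat) (A : 'M[cplx R]_n) : Prop :=
  forall v : 'cV[cplx R]_n, 0 <= (map_mx Num.conj v^T *m A *m v) 0 0.

Definition npoint_positive (R : realType) (d : nat) (Omega : set (cspace R d))
    (n : nat) (L : cspace R d -> cspace R d -> cplx R) : Prop :=
  forall x : 'I_n -> cspace R d, (forall i, Omega (x i)) ->
    psdmx (\matrix_(i, j) L (x i) (x j)).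

(* The infimum of the empty set is +oo in \bar R. *)
Definition mult_norm (R : realType) (d : nat) (Omega : set (cspace R d))
    (K : cspace R d -> cspace R d -> cplx R) (n : nat)
    (phi : cspace R d -> cplx R) : \bar R :=
  ereal_inf [set C%:E | C in [set C : R | 0 <= C /\
    npoint_positive Omega n
      (fun z w => K z w * ((C ^+ 2)%:C%C - phi z * (phi w)^*))]].

(* Main.v *)
Require Import Defs.
From HB Require Import structures.
From mathcomp Require Import all_boot all_order all_algebra.
From mathcomp Require Import finmap complex ring lra.
From mathcomp Require Import all_classical all_reals all_analysis.
From mathcomp.analysis.showcase Require Import summability.
Import Order.TTheory GRing.Theory Num.Theory.
Import numFieldNormedType.Exports.
Set Implicit Arguments.
Unset Strict Implicit.
Unset Printing Implicit Defensive.
Local Open Scope classical_set_scope.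
Local Open Scope ring_scope.

(** Idea of the proof. Let k_x be the kernel function at x. Three-point
    positivity says that the linear map sending k_x to the conjugate of phi(x)
    times k_x has norm at most C on the span of any three kernel functions. So
    if a combination of three kernel functions is small, it stays small after
    phi has been inserted. The combinations that matter are the values, the
    first differences, and the second differences
      f (x + t v) - t f (x + v) - (1 - t) f x
    along complex lines; three points are exactly what the last ones require.
    A bound of the size O(|v|^2 |t| |t - 1|) on the last ones says that f is
    complex affine to first order, with a uniform quadratic error. A function
    whose three kinds of differences are bounded in this way on a polydisc is
    called tame here.

    Every f in H is tame near a, by its power series ([analytic_tame]). A
    category argument makes the polydisc and the constant independent of f, the
    constant being proportional to the norm of f ([tame_uniform]). By duality
    the difference combinations of kernel functions are then small in norm, so
    that phi * f is tame for each f in H ([tame_multiplier]). With f := k_a,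
    for which f a = K a a <> 0, the Leibniz rules for products and inverses
    ([tameM], [tameV]) show that phi itself is tame near a.

    It remains to see that tame functions are analytic ([tame_analytic]). This
    is the theory of Cauchy, done on finite grids of roots of unity, where
    integrals are averages. For the N-th roots of unity let P_N be the
    polynomial interpolating f on the torus grid around a. Then P_N z is the
    average of f (zeta) against truncated Cauchy kernels, and contracting the
    torus to the point z deforms that average into f z. Along the deformation
    the first order part telescopes around each circle and only the quadratic
    errors remain; they add up to O(|w - 1|), with w a primitive N-th root of
    unity near 1 ([deform1_close]). Hence P_N converges to f on a polydisc; an
    ultrafilter limit of the coefficients of P_N gives the power series of f. *)

#[local] Existing Instance totally_filter.

(** * Real-valued modulus and polydiscs *)

Section Modulus.
Context {R : realType}.
Implicit Types x y z : cplx R.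

(** The modulus as an element of R, where the order is total: all estimates
    below are real inequalities. *)
Definition cabs z : R := complex.Re `|z|.

Lemma cabsE z : `|z| = (cabs z)%:C%C.
Proof. by rewrite /cabs (RRe_real (normr_real z)). Qed.

Lemma cabs_lt z (r : R) : (`|z| < r%:C%C) = (cabs z < r).
Proof. by rewrite cabsE ltcR. Qed.

Lemma ltr0C (r : R) : (0 < r%:C%C :> cplx R) = (0 < r).
Proof. exact: (ltcR 0 r). Qed.

Lemma cabs_ge0 z : 0 <= cabs z.
Proof. by rewrite -ler0c -cabsE. Qed.

Lemma cabs0 : cabs 0 = 0. Proof. by rewrite /cabs normr0. Qed.
Lemma cabs1 : cabs 1 = 1. Proof. by rewrite /cabs normr1. Qed.

Lemma cabsM x y : cabs (x * y) = cabs x * cabs y.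
Proof. by apply: complexI; rewrite rmorphM/= -!cabsE normrM. Qed.

Lemma cabsN x : cabs (- x) = cabs x.
Proof. by rewrite /cabs normrN. Qed.

Lemma cabsB x y : cabs (x - y) = cabs (y - x).
Proof. by rewrite /cabs distrC. Qed.

Lemma cabs_eq0 x : (cabs x == 0) = (x == 0).
Proof. by rewrite -[RHS]normr_eq0 cabsE -(inj_eq (@complexI R)). Qed.

Lemma cabs_gt0 x : (0 < cabs x) = (x != 0).
Proof. by rewrite lt_neqAle cabs_ge0 eq_sym cabs_eq0 andbT. Qed.

Lemma cabsV x : cabs x^-1 = (cabs x)^-1.
Proof. by apply: complexI; rewrite fmorphV/= -!cabsE normfV. Qed.

Lemma cabsX x n : cabs (x ^+ n) = cabs x ^+ n.
Proof. by elim: n => [|n IH]; rewrite ?cabs1// !exprS cabsM IH. Qed.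

Lemma cabsD x y : cabs (x + y) <= cabs x + cabs y.
Proof. by rewrite -lecR rmorphD/= -!cabsE ler_normD. Qed.

Lemma cabs_real (r : R) : cabs r%:C%C = `|r|.
Proof. by apply: complexI; rewrite -cabsE normc_def/= expr0n/= addr0 sqrtr_sqr. Qed.

Lemma cabs_nat n : cabs n%:R = n%:R.
Proof. by rewrite -[n%:R](rmorph_nat (real_complex R)) cabs_real normr_nat. Qed.

Lemma cabs_sum (I : Type) (s : seq I) (P : pred I) (F : I -> cplx R) :
  cabs (\sum_(i <- s | P i) F i) <= \sum_(i <- s | P i) cabs (F i).
Proof.
elim/big_rec2: _ => [|i y1 y2 _ IH]; first by rewrite cabs0.
by apply: (le_trans (cabsD _ _)); rewrite lerD2l.
Qed.

Lemma cabs_prod (I : Type) (s : seq I) (P : pred I) (F : I -> cplx R) :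
  cabs (\prod_(i <- s | P i) F i) = \prod_(i <- s | P i) cabs (F i).
Proof. by elim/big_rec2: _ => [|i y1 y2 _ <-]; rewrite ?cabs1 ?cabsM. Qed.

Lemma cabs_le2 x y (a b : R) : cabs x <= a -> cabs y <= b -> cabs (x + y) <= a + b.
Proof. by move=> ? ?; apply: (le_trans (cabsD _ _)); exact: lerD. Qed.

Lemma cabs_leM x y (a b : R) : cabs x <= a -> cabs y <= b -> cabs (x * y) <= a * b.
Proof. by move=> ? ?; rewrite cabsM; apply: ler_pM; rewrite ?cabs_ge0. Qed.

Lemma cvg_cabsP (T : Type) (F : set_system T) {FF : Filter F} (f : T -> cplx R) l :
  (f @ F --> l) <-> forall e : R, 0 < e -> \forall t \near F, cabs (f t - l) < e.
Proof.
split=> [/cvgrPdist_lt fl e e0|H].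
  have := fl e%:C%C; rewrite ltr0C => /(_ e0).
  by apply: filterS => t; rewrite distrC cabs_lt.
apply/cvgrPdist_lt => e e0.
have er : e = (complex.Re e)%:C%C by rewrite RRe_real// gtr0_real.
move: e0; rewrite er ltr0C => e0.
by apply: filterS (H _ e0) => t; rewrite distrC cabs_lt.
Qed.

End Modulus.

Section Polydisc.
Context {R : realType} {d : nat}.
Implicit Types a x y v : cspace R d.

(** Polydiscs, rather than norm balls, keep every estimate coordinatewise and
    cover dimension 0 as well. *)
Definition polydisc a (s : R) : set (cspace R d) :=
  [set x | forall j, cabs (x 0 j - a 0 j) < s].

Lemma nbhs_polydiscP a (A : set (cspace R d)) :
  nbhs a A <-> exists2 s : R, 0 < s & polydisc a s `<=` A.
Proof.
split=> [/nbhs_ballP[e /= e0 eA]|[s s0 sA]].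
  have er : e = (complex.Re e)%:C%C by rewrite RRe_real// gtr0_real.
  exists (complex.Re e); first by rewrite -ltr0C -er.
  move=> x xa; apply: eA; split=> // i j; rewrite ord1.
  by rewrite -ball_normE /= er cabs_lt cabsB.
apply/nbhs_ballP; exists s%:C%C => /=; first by rewrite ltr0C.
move=> x [_ xa]; apply: sA => j; have := xa 0 j.
by rewrite -ball_normE /= cabs_lt cabsB.
Qed.

Lemma polydisc_center a s : 0 < s -> polydisc a s a.
Proof. by move=> s0 j; rewrite subrr cabs0. Qed.

Lemma polydiscS a s t : s <= t -> polydisc a s `<=` polydisc a t.
Proof. by move=> st x xa j; apply: lt_le_trans (xa j) st. Qed.

End Polydisc.

(** * Functions with bounded second differences *)

Section Tame.
Context {R : realType} {d : nat}.
Implicit Types (a x y v : cspace R d) (f g : cspace R d -> cplx R).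

Definition triple (T : Type) (x y z : T) : 'I_3 -> T :=
  fun i => nth x [:: x; y; z] i.

Lemma sum_triple f (c0 c1 c2 : cplx R) x y z :
  \sum_i triple c0 c1 c2 i * f (triple x y z i) = c0 * f x + c1 * f y + c2 * f z.
Proof. by rewrite !big_ord_recl big_ord0 /= addr0 addrA. Qed.

(** The constructor arguments list weights c and points p of a combination
    \sum_i c i * f (p i), and the size b that such a combination must not exceed,
    up to a constant. The three kinds of combinations are put into one relation,
    with three points each, because the category argument and the multiplier
    estimate treat them alike. Sizes are scaled by s so that one constant serves
    for all three kinds, and shrinking the polydisc only increases them.
    The bound 0 <= nu excludes negative sizes in dimension 0. *)
Inductive difference a (s : R) :
    ('I_3 -> cplx R) -> ('I_3 -> cspace R d) -> R -> Prop :=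
| difference0 x : polydisc a s x ->
    difference a s (triple 1 0 0) (triple x x x) 1
| difference1 x y (nu : R) : 0 <= nu -> polydisc a s x -> polydisc a s y ->
    (forall j, cabs (x 0 j - y 0 j) <= nu) ->
    difference a s (triple 1 (-1) 0) (triple x y y) (nu / s)
| difference2 x v t (nu : R) : 0 <= nu ->
    polydisc a s x -> polydisc a s (x + v) -> polydisc a s (x + t *: v) ->
    (forall j, cabs (v 0 j) <= nu) ->
    difference a s (triple 1 (- t) (t - 1)) (triple (x + t *: v) (x + v) x)
      ((nu / s) ^+ 2 * (cabs t * cabs (t - 1))).

Definition tame a (s : R) f (M : R) : Prop :=
  forall c p b, difference a s c p b ->
    cabs (\sum_i c i * f (p i)) <= M * b.

Lemma tameP a s f M : tame a s f M <->
  [/\ forall x, polydisc a s x -> cabs (f x) <= M,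
      forall x y nu, 0 <= nu -> polydisc a s x -> polydisc a s y ->
        (forall j, cabs (x 0 j - y 0 j) <= nu) ->
        cabs (f x - f y) <= M * (nu / s) &
      forall x v t nu, 0 <= nu ->
        polydisc a s x -> polydisc a s (x + v) -> polydisc a s (x + t *: v) ->
        (forall j, cabs (v 0 j) <= nu) ->
        cabs (f (x + t *: v) - t * f (x + v) - (1 - t) * f x)
          <= M * ((nu / s) ^+ 2 * (cabs t * cabs (t - 1)))].
Proof.
have E := sum_triple f.
split=> [H|[H0 H1 H2] c p b].
  split=> [x ax|x y nu nu0 ax ay xy|x v t nu nu0 ax axv axt vn].
  - by have := H _ _ _ (difference0 ax); rewrite E !mul0r !addr0 mul1r mulr1.
  - by have := H _ _ _ (difference1 nu0 ax ay xy); rewrite E mul0r addr0 mul1r mulN1r.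
  - have := H _ _ _ (difference2 nu0 ax axv axt vn); rewrite E mul1r mulNr.
    by congr (cabs _ <= _); ring.
case=> {c p b}[x ax|x y nu nu0 ax ay xy|x v t nu nu0 ax axv axt vn]; rewrite E.
- by rewrite !mul0r !addr0 mul1r mulr1; exact: H0.
- by rewrite mul0r addr0 mul1r mulN1r; exact: H1.
- have := H2 _ _ _ _ nu0 ax axv axt vn; rewrite mul1r mulNr.
  by congr (cabs _ <= _); ring.
Qed.

Lemma difference_ge0 a s c p b : 0 < s -> difference a s c p b -> 0 <= b.
Proof.
move=> s0; case=> {c p b}[//|x y nu nu0 *|x v t nu nu0 *].
  by rewrite divr_ge0// ltW.
by rewrite mulr_ge0 ?sqr_ge0 ?mulr_ge0 ?cabs_ge0.
Qed.

Lemma difference_polydisc a s c p b i : difference a s c p b -> polydisc a s (p i).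
Proof. by case=> *; case: i => [[|[|[|//]]]]. Qed.

Lemma tame_ge0 a s f M : 0 < s -> tame a s f M -> 0 <= M.
Proof.
move=> s0 /tameP[H _ _]; exact: le_trans (cabs_ge0 _) (H a (polydisc_center a s0)).
Qed.

Lemma difference_mono a s t c p b : 0 < t -> t <= s -> difference a t c p b ->
  exists2 b', difference a s c p b' & b' <= b.
Proof.
move=> t0 ts D.
have sub : polydisc a t `<=` polydisc a s by exact: polydiscS.
have s0 (nu : R) : 0 <= nu -> 0 <= nu / s.
  by move=> nu0; rewrite divr_ge0// ltW// (lt_le_trans t0).
have lest (nu : R) : 0 <= nu -> nu / s <= nu / t.
  by move=> nu0; rewrite ler_wpM2l// lef_pV2// posrE (lt_le_trans t0).
case: D => {c p b}[x /sub ax|x y nu nu0 /sub ax /sub ay xy|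
                   x v c nu nu0 /sub ax /sub ay /sub az vn].
- by exists 1 => //; exact: difference0.
- by exists (nu / s); [exact: difference1|exact: lest].
- exists ((nu / s) ^+ 2 * (cabs c * cabs (c - 1))); first exact: difference2.
  apply: ler_wpM2r; first by rewrite mulr_ge0 ?cabs_ge0.
  by rewrite ler_sqr ?nnegrE ?s0 ?lest// (le_trans (s0 _ nu0))// lest.
Qed.

Lemma tame_mono a s t f M N : 0 < t -> t <= s -> M <= N ->
  tame a s f M -> tame a t f N.
Proof.
move=> t0 ts MN fM c p b D.
have s0 := lt_le_trans t0 ts.
have [b' D' bb'] := difference_mono t0 ts D.
apply: le_trans (fM _ _ _ D') _.
by apply: ler_pM => //; [exact: tame_ge0 fM|exact: difference_ge0 D'].
Qed.

Lemma eq_tame a s f g M : {in polydisc a s, f =1 g} -> tame a s f M -> tame a s g M.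
Proof.
move=> fg fM c p b D; have := fM _ _ _ D; congr (cabs _ <= _).
by apply: eq_bigr => i _; rewrite fg// inE; exact: difference_polydisc D.
Qed.

(** The Leibniz rule: a difference of a product splits into three terms, each
    bounded by the product of the constants. The error term of second order is
    the product of two first differences. *)
Lemma tameM a s f g M N : 0 < s -> tame a s f M -> tame a s g N ->
  tame a s (fun x => f x * g x) (3 * (M * N)).
Proof.
move=> s0 fM gN.
have M0 := tame_ge0 s0 fM; have N0 := tame_ge0 s0 gN.
have MN0 : 0 <= M * N by exact: mulr_ge0.
move/tameP: fM => [f0 f1 f2]; move/tameP: gN => [g0 g1 g2]; apply/tameP; split.
- move=> x ax; apply: le_trans (cabs_leM (f0 _ ax) (g0 _ ax)) _; nra.
- move=> x y nu nu0 ax ay xy.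
  have q0 : 0 <= nu / s by rewrite divr_ge0// ltW.
  have -> : f x * g x - f y * g y = (f x - f y) * g x + f y * (g x - g y) by ring.
  apply: le_trans (cabs_le2 (cabs_leM (f1 _ _ _ nu0 ax ay xy) (g0 _ ax))
    (cabs_leM (f0 _ ay) (g1 _ _ _ nu0 ax ay xy))) _.
  set q := nu / s in q0 *.
  have : 0 <= M * N * q by exact: mulr_ge0.
  lra.
- move=> x v t nu nu0 ax ay az vn.
  have q0 : 0 <= nu / s by rewrite divr_ge0// ltW.
  set y := x + v; set z := x + t *: v.
  (* Only the last term below is not a second difference of a factor; it is
     small because y - x and z - y have sizes |v| and |t - 1| |v|. *)
  have -> : f z * g z - t * (f y * g y) - (1 - t) * (f x * g x) =
     f x * (g z - t * g y - (1 - t) * g x)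
     + (f z - t * f y - (1 - t) * f x) * g z
     + t * (f y - f x) * (g z - g y) by ring.
  have yx j : cabs (y 0 j - x 0 j) <= nu by rewrite /y mxE addrC addKr.
  have zy j : cabs (z 0 j - y 0 j) <= cabs (t - 1) * nu.
    rewrite /z /y !mxE opprD addrACA subrr add0r -{2}[v 0 j]mul1r -mulrBl cabsM.
    by rewrite ler_wpM2l ?cabs_ge0.
  have tnu0 : 0 <= cabs (t - 1) * nu by rewrite mulr_ge0 ?cabs_ge0.
  apply: le_trans (cabs_le2 (cabs_le2
     (cabs_leM (f0 _ ax) (g2 _ _ _ _ nu0 ax ay az vn))
     (cabs_leM (f2 _ _ _ _ nu0 ax ay az vn) (g0 _ az)))
     (cabs_leM (cabs_leM (lexx (cabs t)) (f1 _ _ _ nu0 ay ax yx))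
        (g1 _ _ _ tnu0 az ay zy))) _.
  by rewrite le_eqVlt; apply/orP; left; apply/eqP; field; rewrite gt_eqF.
Qed.

Lemma tame_cst a s (c : cplx R) : 0 < s -> tame a s (fun=> c) (cabs c).
Proof.
move=> s0; apply/tameP; split=> // [x y nu nu0 _ _ _|x v t nu nu0 _ _ _ _].
  by rewrite subrr cabs0 mulr_ge0 ?cabs_ge0// divr_ge0// ltW.
rewrite (_ : _ - _ = 0) ?cabs0; last by ring.
by rewrite mulr_ge0 ?cabs_ge0// mulr_ge0 ?sqr_ge0// mulr_ge0 ?cabs_ge0.
Qed.

Lemma tame_coord a s j : 0 < s -> tame a s (fun x => x 0 j - a 0 j) s.
Proof.
move=> s0; apply/tameP; split=> [x ax|x y nu nu0 _ _ xy|x v t nu nu0 _ _ _ _].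
- exact/ltW/ax.
- by rewrite opprB addrA subrK mulrC divfK ?gt_eqF.
- rewrite !mxE (_ : _ - _ = 0) ?cabs0; last by ring.
  by rewrite mulr_ge0 ?(ltW s0)// mulr_ge0 ?sqr_ge0// mulr_ge0 ?cabs_ge0.
Qed.

Lemma tame_sum a s (I : Type) (r : seq I) (F : I -> cspace R d -> cplx R)
    (c : I -> cplx R) (M : I -> R) :
  (forall i, tame a s (F i) (M i)) ->
  tame a s (fun x => \sum_(i <- r) c i * F i x) (\sum_(i <- r) cabs (c i) * M i).
Proof.
move=> FM w p b D.
under eq_bigr do rewrite mulr_sumr.
rewrite exchange_big/= mulr_suml; apply: le_trans (cabs_sum _ _ _) _.
apply: ler_sum => i _; under eq_bigr do rewrite mulrCA.
by rewrite -mulr_sumr -mulrA; apply: cabs_leM => //; exact: FM.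
Qed.

(** Tameness is a family of closed conditions, each on finitely many values. *)
Lemma tame_lim a s (T : Type) (G : set_system T) (GG : ProperFilter G)
    (F : T -> cspace R d -> cplx R) f M :
  (forall i, tame a s (F i) M) ->
  (forall x, polydisc a s x -> F ^~ x @ G --> f x) ->
  tame a s f M.
Proof.
move=> FM Ff c p b D; apply/ler_addgt0Pl => e e0.
have lim : (fun i => \sum_k c k * F i (p k)) @ G --> \sum_k c k * f (p k).
  apply: cvg_big => [|k _]; first exact: add_continuous.
  by apply: cvgMl_tmp; apply: Ff; exact: difference_polydisc D.
move/cvg_cabsP: lim => /(_ e e0)/filter_ex[i He].
rewrite -[X in cabs X](subrK (\sum_k c k * F i (p k))).
apply: cabs_le2; last exact: FM.
by rewrite cabsB ltW.
Qed.

(** Near a the function stays away from 0, by its Lipschitz bound; the second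
    difference of 1 / f is then obtained from the Leibniz rule applied to
    f * (1 / f) = 1. *)
Lemma tameV a s f M : 0 < s -> tame a s f M -> f a != 0 ->
  exists2 t, 0 < t <= s & (forall x, polydisc a t x -> f x != 0) /\
    exists N, tame a t (fun x => (f x)^-1) N.
Proof.
move=> s0 fM fa0.
have M0 := tame_ge0 s0 fM.
set m := cabs (f a); have m0 : 0 < m by rewrite cabs_gt0.
(* On the polydisc of radius t, f varies by at most |f a| / 2. *)
set t : R := Num.min s (s * m / (2 * (M + 1))).
have t0 : 0 < t.
  by rewrite lt_min s0/= divr_gt0 ?mulr_gt0//; lra.
have ts : t <= s by rewrite ge_min lexx.
have MtV : M * (t / s) <= m / 2.
  have : t <= s * m / (2 * (M + 1)) by rewrite ge_min lexx orbT.
  have M10 : 0 < 2 * (M + 1) by lra.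
  rewrite ler_pdivlMr// => H.
  rewrite mulrA ler_pdivrMr//; nra.
have low x : polydisc a t x -> m / 2 <= cabs (f x).
  move=> ax; move/tameP: fM => [_ f1 _].
  have := f1 x a t (ltW t0) (polydiscS ts ax) (polydisc_center a s0)
    (fun j => ltW (ax j)).
  move=> /le_trans/(_ MtV); have := cabsD (f x) (f a - f x).
  by rewrite addrC subrK -/m [cabs (f a - _)]cabsB; lra.
set q := 2 / m; have q0 : 0 < q by rewrite divr_gt0.
have gq x : polydisc a t x -> cabs (f x)^-1 <= q.
  move=> /low H; rewrite cabsV /q -[2 / m]invf_div lef_pV2// posrE;
    last by rewrite divr_gt0.
  by apply: lt_le_trans H; rewrite divr_gt0.
have fn0 x : polydisc a t x -> f x != 0.
  by move=> /low H; rewrite -cabs_gt0; apply: lt_le_trans H; rewrite divr_gt0.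
have [f0 f1 f2] := (tameP _ _ _ _).1 (tame_mono t0 ts (lexx M) fM).
have g1 x y nu : 0 <= nu -> polydisc a t x -> polydisc a t y ->
    (forall j, cabs (x 0 j - y 0 j) <= nu) ->
    cabs ((f x)^-1 - (f y)^-1) <= M * q ^+ 2 * (nu / t).
  move=> nu0 ax ay xy.
  have -> : (f x)^-1 - (f y)^-1 = - (f x - f y) * (f x)^-1 * (f y)^-1.
    by field; rewrite !fn0.
  apply: (@le_trans _ _ (M * (nu / t) * q * q)); last by lra.
  by apply: cabs_leM (gq _ ay); apply: cabs_leM (gq _ ax); rewrite cabsN; exact: f1.
exists t; [by rewrite t0|split=> //].
have Mq0 : 0 <= M * q by rewrite mulr_ge0// ltW.
have Mqq0 : 0 <= M * q ^+ 2 by rewrite mulr_ge0// sqr_ge0.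
have Mqqq0 : 0 <= M ^+ 2 * q ^+ 3 by rewrite mulr_ge0 ?sqr_ge0// exprn_ge0// ltW.
exists (q + M * q ^+ 2 + M ^+ 2 * q ^+ 3); apply/tameP; split.
- by move=> x ax; have := gq _ ax; lra.
- move=> x y nu nu0 ax ay xy; apply: le_trans (g1 _ _ _ nu0 ax ay xy) _.
  apply: ler_wpM2r; first by rewrite divr_ge0// ltW.
  lra.
- move=> x v c nu nu0 ax ay az vn.
  set y := x + v in ay *; set z := x + c *: v in az *.
  have yx j : cabs (y 0 j - x 0 j) <= nu by rewrite /y mxE addrC addKr.
  have zy j : cabs (z 0 j - y 0 j) <= cabs (c - 1) * nu.
    rewrite /z /y !mxE opprD addrACA subrr add0r -{2}[v 0 j]mul1r -mulrBl cabsM.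
    by rewrite ler_wpM2l ?cabs_ge0.
  have tnu0 : 0 <= cabs (c - 1) * nu by rewrite mulr_ge0 ?cabs_ge0.
  have -> : (f z)^-1 - c * (f y)^-1 - (1 - c) * (f x)^-1 =
     - ((f z - c * f y - (1 - c) * f x) * (f z)^-1
     + c * (f y - f x) * ((f z)^-1 - (f y)^-1)) * (f x)^-1.
    by field; rewrite !fn0.
  apply: le_trans (cabs_leM (b := q) _ (gq _ ax)) _; first rewrite cabsN.
    exact: (cabs_le2 (cabs_leM (f2 _ _ _ _ nu0 ax ay az vn) (gq _ az))
      (cabs_leM (cabs_leM (lexx (cabs c)) (f1 _ _ _ nu0 ay ax yx))
        (g1 _ _ _ tnu0 az ay zy))).
  set w := (nu / t) ^+ 2 * _.
  have w0 : 0 <= w by rewrite mulr_ge0 ?sqr_ge0// mulr_ge0 ?cabs_ge0.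
  apply: (@le_trans _ _ ((M * q ^+ 2 + M ^+ 2 * q ^+ 3) * w)).
    by rewrite le_eqVlt; apply/orP; left; apply/eqP; rewrite /w; field; rewrite gt_eqF.
  by apply: ler_wpM2r => //; lra.
Qed.

End Tame.

(** * Analytic functions are tame *)

Section Boxes.
Context {d : nat}.
Local Notation multi := {ffun 'I_d -> nat}.

Definition box (N : nat) : {fset multi} :=
  [fset ([ffun j => val (al j)] : multi) | al : {ffun 'I_d -> 'I_N} in predT]%fset.

Lemma in_box N (al : multi) : (al \in box N) = [forall j, (al j < N)%N].
Proof.
apply/imfsetP/forallP => [[be _ ->] j|H]; first by rewrite ffunE; exact: ltn_ord.
exists [ffun j => Ordinal (H j)] => //.
by apply/ffunP => j; rewrite !ffunE.
Qed.

(** A sum over a box of multi-indices of a product of one-variable terms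
    factors; this turns geometric series in several variables, and products of
    one-variable kernels, into one-variable sums. *)
Lemma sum_box (A : comPzRingType) (F : 'I_d -> nat -> A) N :
  \sum_(al <- box N) \prod_j F j (al j) = \prod_j \sum_(m < N) F j m.
Proof.
rewrite bigA_distr_bigA/= big_imfset/=; last first.
  move=> al be _ _ /ffunP E; apply/ffunP => j; apply/val_inj.
  by have := E j; rewrite !ffunE.
rewrite big_enum/=; apply: eq_bigr => al _.
by apply: eq_bigr => j _; rewrite ffunE.
Qed.

Lemma boxS m n : (m <= n)%N -> (box m `<=` box n)%fset.
Proof.
move=> mn; apply/fsubsetP => al; rewrite !in_box => /forallP H.
by apply/forallP => j; apply: leq_trans mn.
Qed.

Lemma fset_sub_box (F : {fset multi}) : exists N, (F `<=` box N)%fset.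
Proof.
exists (\max_(al <- F) \max_j al j).+1.
apply/fsubsetP => al aF; rewrite in_box; apply/forallP => j; rewrite ltnS.
rewrite (big_fsetD1 al)//=; apply: leq_trans (leq_maxl _ _).
exact: (leq_bigmax j).
Qed.

End Boxes.

Section Analytic.
Context {R : realType} {d : nat}.
Implicit Types (a x y v : cspace R d) (f g : cspace R d -> cplx R).
Local Notation multi := {ffun 'I_d -> nat}.

Lemma partial_sumE (I : choiceType) (V : zmodType) (x : I -> V) (A : {fset I}) :
  partial_sum x A = \sum_(i <- A) x i.
Proof. by rewrite /partial_sum big_seq_fsetE. Qed.

Lemma sum_fset_split (I : choiceType) (V : nmodType) (u : I -> V) (F G : {fset I}) :
  (F `<=` G)%fset ->
  \sum_(i <- G) u i = \sum_(i <- F) u i + \sum_(i <- (G `\` F)%fset) u i.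
Proof.
move=> FG; rewrite (big_fsetID _ (mem F))/=; congr (_ + _).
  apply: eq_fbigl => i; rewrite !inE/= andbC.
  by case: (boolP (i \in F)) => // /(fsubsetP FG)->.
by apply: eq_fbigl => i; rewrite !inE/= andbC.
Qed.

Lemma sum_half N : \sum_(m < N) (2^-1 : R) ^+ m = 2 - 2 * 2^-1 ^+ N.
Proof.
elim: N => [|N IH]; first by rewrite big_ord0 expr0 mulr1 subrr.
rewrite big_ord_recr/= IH exprS; lra.
Qed.

Lemma tameX a s f M n : 0 < s -> tame a s f M ->
  tame a s (fun x => f x ^+ n) ((3 * M) ^+ n).
Proof.
move=> s0 fM; elim: n => [|n IH].
  by have := @tame_cst R d a s 1 s0; rewrite cabs1.
by rewrite exprS -mulrA; apply: eq_tame (tameM s0 fM IH) => x _; rewrite exprS.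
Qed.

Lemma tame_prod a s (I : Type) (r : seq I) (F : I -> cspace R d -> cplx R)
    (M : I -> R) : 0 < s -> (forall i, tame a s (F i) (M i)) ->
  tame a s (fun x => \prod_(i <- r) F i x) (\prod_(i <- r) (3 * M i)).
Proof.
move=> s0 FM; elim: r => [|i r IH].
  rewrite big_nil; have := @tame_cst R d a s 1 s0; rewrite cabs1.
  by apply: eq_tame => x _; rewrite big_nil.
rewrite big_cons -mulrA; apply: eq_tame (tameM s0 (FM i) IH) => x _.
by rewrite big_cons.
Qed.

Lemma tame_monomial a s (al : multi) : 0 < s ->
  tame a s (fun z => monomial al (z - a)) (\prod_j (3 * (3 * s) ^+ al j)).
Proof.
move=> s0; have := tame_prod (index_enum 'I_d) s0
  (fun j => tameX (al j) s0 (@tame_coord R d a s j s0)).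
by apply: eq_tame => x _; apply: eq_bigr => j _; rewrite !mxE.
Qed.

(** Adding one index to a large finite set moves the partial sum by less
    than 2. *)
Lemma terms_bounded (I : choiceType) (u : I -> cplx R) (l : cplx R) :
  partial_sum u @ totally --> l -> exists2 B, 0 <= B & forall i, cabs (u i) <= B.
Proof.
move/cvg_cabsP => /(_ 1 ltr01)[F0 _ HF0].
exists (2 + \sum_(i <- F0) cabs (u i)).
  by rewrite addr_ge0// sumr_ge0// => i _; exact: cabs_ge0.
move=> i; have [iF|iF] := boolP (i \in F0).
  rewrite (big_fsetD1 i)//= addrCA lerDl addr_ge0// sumr_ge0// => k _.
  exact: cabs_ge0.
have := HF0 F0 (fsubset_refl _) => /= H1.
have := HF0 (i |` F0)%fset (fsubsetU1 _ _) => /= H2.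
have {1}-> : u i = (partial_sum u (i |` F0)%fset - l) - (partial_sum u F0 - l).
  by rewrite !partial_sumE big_fsetU1//=; ring.
apply: (@le_trans _ _ 2); last first.
  by rewrite lerDl sumr_ge0// => k _; exact: cabs_ge0.
by apply: (cabs_le2 (a := 1) (b := 1)); rewrite ?cabsN; exact: ltW.
Qed.

(** Convergence at a point with all coordinates at distance r from a bounds
    the terms |c_alpha| r^|alpha|. A monomial is a product of coordinates, so by
    the Leibniz rule its tameness constant on a smaller polydisc is geometrically
    smaller than r^|alpha|, and the partial sums are uniformly tame. *)
Lemma analytic_tame a f : analytic_at f a ->
  exists2 s, 0 < s & exists M, tame a s f M.
Proof.
move=> [c /nbhs_polydiscP[rho rho0 Hc]].
set r := rho / 2; have r0 : 0 < r by rewrite divr_gt0.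
set z0 : cspace R d := a + const_mx r%:C%C.
have /Hc/terms_bounded[B B0 HB] : polydisc a rho z0.
  by move=> j; rewrite /z0 !mxE [a 0 j + _]addrC addrK cabs_real gtr0_norm// /r; lra.
have {}HB al : cabs (c al) * \prod_j r ^+ al j <= B.
  have := HB al; rewrite cabsM cabs_prod; congr (_ * _ <= _).
  by apply: eq_bigr => j _; rewrite /z0 !mxE [a 0 j + _]addrC addrK cabsX cabs_real
    gtr0_norm.
(* A coordinate costs a factor 3 * s = r / 2 by the Leibniz rule, half of
   what the convergence at z0 allows. *)
set s := r / 6; have s0 : 0 < s by rewrite divr_gt0.
exists s => //; exists (B * 6 ^+ d).
apply: (@tame_lim _ _ _ _ {fset multi} totally _
  (fun F z => partial_sum (fun al => c al * monomial al (z - a)) F)); last first.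
  by move=> x ax; apply: Hc; apply: polydiscS ax; rewrite /s /r; lra.
move=> F.
have [N FN] := fset_sub_box F.
apply: (@eq_tame _ _ _ _ (fun z => \sum_(al <- F) c al * monomial al (z - a))).
  by move=> z _; rewrite partial_sumE.
apply: tame_mono s0 (lexx s) _
  (tame_sum (enum_fset F) c (fun al => @tame_monomial a s al s0)).
apply: (@le_trans _ _ (B * \sum_(al <- F) \prod_j (3 * 2^-1 ^+ al j))).
  rewrite mulr_sumr; apply: ler_sum => al _.
  have -> : \prod_j (3 * (3 * s) ^+ al j) =
            (\prod_j r ^+ al j) * \prod_j (3 * 2^-1 ^+ al j).
    rewrite -big_split/=; apply: eq_bigr => j _.
    rewrite [RHS]mulrCA; congr (_ * _); rewrite -exprMn; congr (_ ^+ _).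
    by rewrite /s; lra.
  rewrite mulrA; apply: ler_wpM2r => //.
  by apply: prodr_ge0 => j _; rewrite mulr_ge0// exprn_ge0.
apply: ler_wpM2l => //.
apply: (@le_trans _ _ (\sum_(al <- box N) \prod_j (3 * 2^-1 ^+ al j))).
  rewrite [leRHS](sum_fset_split _ FN).
  rewrite lerDl sumr_ge0// => al _.
  by apply: prodr_ge0 => j _; rewrite mulr_ge0// exprn_ge0.
rewrite (sum_box (fun _ m => 3 * 2^-1 ^+ m)).
rewrite -mulr_sumr sum_half prodr_const. rewrite cardT size_enum_ord.
apply: lerXn2r; rewrite ?nnegrE//; last first.
- rewrite -[leRHS]addr0; have : 0 <= (2^-1 : R) ^+ N by exact: exprn_ge0.
  lra.
- rewrite -sum_half mulr_ge0// sumr_ge0// => i _; exact: exprn_ge0.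
Qed.

End Analytic.

(** * First-order expansion of tame functions *)

Section Increments.
Context {R : realType} {d : nat}.
Implicit Types (a x h v : cspace R d) (f : cspace R d -> cplx R).
Context (a : cspace R d) (s M : R) (f : cspace R d -> cplx R).
Context (s0 : 0 < s) (fM : tame a s f M).

Definition mask (J : seq 'I_d) h : cspace R d :=
  \row_j (if j \in J then h 0 j else 0).

(** Second differences along complex lines control mixed ones: x + h + g is
    the midpoint of x + 2 h and x + 2 g, while x + h and x + g are the midpoints
    of x and x + 2 h, and of x and x + 2 g. *)
Lemma mixed_difference x h (g : cspace R d) (rho eta : R) :
  0 <= eta -> rho + 2 * eta < s ->
  (forall j, cabs (x 0 j - a 0 j) <= rho) ->
  (forall j, cabs (h 0 j) <= eta) -> (forall j, cabs (g 0 j) <= eta) ->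
  (forall j, h 0 j = 0 \/ g 0 j = 0) ->
  cabs (f (x + h + g) - f (x + h) - f (x + g) + f x) <= 3 * (M * (eta / s) ^+ 2).
Proof.
move=> eta0 room xa hj gj disj.
have ghj j : cabs (g 0 j - h 0 j) <= eta.
  by case: (disj j) => ->; rewrite ?subr0 // sub0r cabsN.
have hgj j : cabs (h 0 j + g 0 j) <= eta.
  by case: (disj j) => ->; rewrite ?add0r // addr0.
have [f0 f1 f2] := (tameP _ _ _ _).1 fM.
have inP v : (forall j, cabs (v 0 j) <= 2 * eta) -> polydisc a s (x + v).
  move=> vj j; rewrite mxE addrAC; apply: le_lt_trans room.
  exact: cabs_le2.
have le2 (e : cplx R) : cabs e <= eta -> cabs e <= 2 * eta by lra.
have le2' (e : cplx R) : cabs e <= eta -> cabs (2 * e) <= 2 * eta.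
  by move=> ee; rewrite cabsM cabs_nat ler_pM2l.
have second y v : polydisc a s y -> polydisc a s (y + v) ->
    polydisc a s (y + 2 *: v) ->
    (forall j, cabs (v 0 j) <= eta) ->
    cabs (f (y + 2 *: v) - 2 * f (y + v) + f y) <= 2 * (M * (eta / s) ^+ 2).
  move=> ay ayv ay2v vn; have := f2 y v 2 eta eta0 ay ayv ay2v vn.
  rewrite (_ : 2 - 1 = 1); last by ring.
  rewrite cabs1 cabs_nat mulr1 => H.
  rewrite (_ : _ + f y = f (y + 2 *: v) - 2 * f (y + v) - (1 - 2) * f y);
    last by ring.
  by lra.
have ax : polydisc a s x.
  by rewrite -[x]addr0; apply: inP => j; rewrite mxE cabs0 mulr_ge0.
have Hg := second x g ax (inP g (fun j => le2 _ (gj j))).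
have Hh := second x h ax (inP h (fun j => le2 _ (hj j))).
have i2 v : (forall j, cabs (v 0 j) <= eta) -> polydisc a s (x + 2 *: v).
  by move=> vj; apply: inP => j; rewrite mxE; exact: le2'.
have {}Hg := Hg (i2 g gj) gj; have {}Hh := Hh (i2 h hj) hj.
have e1 : x + 2 *: h + (g - h) = x + h + g.
  by apply/rowP => j; rewrite !mxE; ring.
have e2 : x + 2 *: h + 2 *: (g - h) = x + 2 *: g.
  by apply/rowP => j; rewrite !mxE; ring.
have := second (x + 2 *: h) (g - h) (i2 h hj); rewrite e1 e2 => Hm.
have {}Hm : cabs (f (x + 2 *: g) - 2 * f (x + h + g) + f (x + 2 *: h)) <=
    2 * (M * (eta / s) ^+ 2).
  apply: Hm; [|exact: i2|by move=> j; rewrite !mxE; exact: ghj].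
  by rewrite -addrA; apply: inP => j; rewrite mxE; apply: le2.
set D := _ + f x.
have E2 : 2 * D = - (f (x + 2 *: g) - 2 * f (x + h + g) + f (x + 2 *: h))
   + (f (x + 2 *: g) - 2 * f (x + g) + f x) + (f (x + 2 *: h) - 2 * f (x + h) + f x).
  by rewrite /D; ring.
have : cabs (2 * D) <= 2 * (M * (eta / s) ^+ 2) + 2 * (M * (eta / s) ^+ 2) +
    2 * (M * (eta / s) ^+ 2).
  rewrite E2; apply: cabs_le2 Hh; apply: cabs_le2 Hg; by rewrite cabsN.
by rewrite cabsM cabs_nat; lra.
Qed.

(** To second order, the increment of f is the sum of its increments along
    the coordinate axes; coordinates are added one at a time. *)
Lemma coordinate_split x h (rho eta : R) :
  0 <= eta -> rho + 2 * eta < s ->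
  (forall j, cabs (x 0 j - a 0 j) <= rho) -> (forall j, cabs (h 0 j) <= eta) ->
  cabs (f (x + h) - f x - \sum_j (f (x + h 0 j *: delta_mx 0 j) - f x))
    <= d%:R * (3 * (M * (eta / s) ^+ 2)).
Proof.
move=> eta0 room xa hj.
have M0 := tame_ge0 s0 fM.
suff H (J : seq 'I_d) : uniq J ->
    cabs (f (x + mask J h) - f x -
      \sum_(j <- J) (f (x + h 0 j *: delta_mx 0 j) - f x))
      <= (size J)%:R * (3 * (M * (eta / s) ^+ 2)).
  have := H _ (index_enum_uniq 'I_d); have -> : mask (index_enum 'I_d) h = h.
    by apply/rowP => j; rewrite mxE mem_index_enum.
  by rewrite [index_enum _]unlock -enumT size_enum_ord.
elim: J => [_|i J IH /= /andP[iJ uJ]].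
  have -> : mask [::] h = 0 by apply/rowP => j; rewrite !mxE.
  by rewrite big_nil addr0 !subrr cabs0 mul0r.
have {}IH := IH uJ.
pose g : cspace R d := h 0 i *: delta_mx 0 i.
have gE j : g 0 j = if j == i then h 0 i else 0.
  by rewrite !mxE eqxx/= ; case: eqP; rewrite ?mulr1 ?mulr0.
have mE : mask (i :: J) h = mask J h + g.
  apply/rowP => j; rewrite 2!mxE gE in_cons [mask J h 0 j]mxE; case: eqP => [->|_]/=.
    by rewrite (negbTE iJ) add0r.
  by rewrite addr0.
have mJ j : cabs (mask J h 0 j) <= eta by rewrite mxE; case: ifP; rewrite ?cabs0.
have gj j : cabs (g 0 j) <= eta by rewrite gE; case: ifP; rewrite ?cabs0.
have disj j : mask J h 0 j = 0 \/ g 0 j = 0.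
  rewrite gE mxE; case: eqP => [->|_]; last by right.
  by left; rewrite (negbTE iJ).
have Hm := mixed_difference eta0 room xa mJ gj disj.
rewrite mE big_cons addrA.
rewrite (_ : _ - _ =
   (f (x + mask J h + g) - f (x + mask J h) - f (x + g) + f x) +
   (f (x + mask J h) - f x -
     \sum_(j <- J) (f (x + h 0 j *: delta_mx 0 j) - f x))); last first.
  by rewrite -/g; ring.
by rewrite -natr1 mulrDl mul1r addrC; apply: cabs_le2.
Qed.

Lemma ray_difference x j (u t : cplx R) (rho eta tau : R) :
  rho + eta < s -> rho + tau < s ->
  (forall j, cabs (x 0 j - a 0 j) <= rho) ->
  cabs u <= eta -> cabs t <= tau -> t != 0 ->
  cabs (f (x + u *: delta_mx 0 j) - f x -
    u / t * (f (x + t *: delta_mx 0 j) - f x))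
    <= M / s ^+ 2 * (eta * (eta + tau)).
Proof.
move=> re rt xa ue tt t0.
have [f0 f1 f2] := (tameP _ _ _ _).1 fM.
have M0 := tame_ge0 s0 fM.
have eta0 : 0 <= eta by exact: le_trans (cabs_ge0 _) ue.
have tau0 : 0 <= tau by exact: le_trans (cabs_ge0 _) tt.
have vE (c : cplx R) i :
    (c *: delta_mx 0 j : cspace R d) 0 i = if i == j then c else 0.
  by rewrite !mxE eqxx/=; case: eqP; rewrite ?mulr1 ?mulr0.
have inP (c : cplx R) b : 0 <= b -> cabs c <= b -> rho + b < s ->
    polydisc a s (x + c *: delta_mx 0 j).
  move=> b0 cb rb i; rewrite mxE vE addrAC; apply: le_lt_trans rb.
  by apply: cabs_le2 => //; case: ifP; rewrite ?cabs0.
have e1 : u *: delta_mx 0 j = (u / t) *: (t *: delta_mx 0 j) :> cspace R d.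
  by rewrite scalerA divfK.
have ax : polydisc a s x by move=> i; apply: le_lt_trans (xa i) _; lra.
have := f2 x (t *: delta_mx 0 j) (u / t) (cabs t) (cabs_ge0 _) ax (inP _ _ tau0 tt rt).
rewrite -e1 => /(_ (inP _ _ eta0 ue re)) H.
rewrite (_ : _ - _ * _ = f (x + u *: delta_mx 0 j) -
  u / t * f (x + t *: delta_mx 0 j) - (1 - u / t) * f x); last by ring.
apply: le_trans (H _) _; first by move=> i; rewrite vE;
  case: ifP; rewrite ?cabs0 ?cabs_ge0.
rewrite exprMn exprVn [_ ^+ 2 / _]mulrC -!mulrA ler_wpM2l//
  ler_wpM2l ?invr_ge0 ?sqr_ge0//.
have -> : cabs t * (cabs t * (cabs (u / t) * cabs (u / t - 1))) = cabs (u * (u - t)).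
  rewrite -!cabsM; congr cabs; field; exact: t0.
by apply: cabs_leM => //; apply: cabs_le2 => //; rewrite cabsN.
Qed.

(** A total differential without derivatives: the partial derivatives are
    replaced by difference quotients with prescribed small steps t j. In the
    discrete Cauchy formula these steps lead from one grid point to the next. *)
Lemma tangent_difference x h (t : 'I_d -> cplx R) (rho eta tau : R) :
  0 <= eta -> rho + 2 * eta < s -> rho + tau < s ->
  (forall j, cabs (x 0 j - a 0 j) <= rho) -> (forall j, cabs (h 0 j) <= eta) ->
  (forall j, cabs (t j) <= tau) -> (forall j, t j != 0) ->
  cabs (f (x + h) - f x -
    \sum_j h 0 j / t j * (f (x + t j *: delta_mx 0 j) - f x))
    <= d%:R * (M / s ^+ 2 * (eta * (4 * eta + tau))).
Proof.
move=> eta0 room rt xa hj tj t0.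
have re : rho + eta < s by lra.
have H1 := coordinate_split eta0 room xa hj.
have H2 : cabs (\sum_j (f (x + h 0 j *: delta_mx 0 j) - f x -
     h 0 j / t j * (f (x + t j *: delta_mx 0 j) - f x))) <=
     d%:R * (M / s ^+ 2 * (eta * (eta + tau))).
  apply: le_trans (cabs_sum _ _ _) _.
  apply: (@le_trans _ _ (\sum_(j < d) (M / s ^+ 2 * (eta * (eta + tau))))).
    by apply: ler_sum => j _; exact: (ray_difference j re rt xa (hj j) (tj j) (t0 j)).
  by rewrite sumr_const card_ord mulr_natl.
rewrite (_ : _ - _ =
  (f (x + h) - f x - \sum_j (f (x + h 0 j *: delta_mx 0 j) - f x)) +
  \sum_j (f (x + h 0 j *: delta_mx 0 j) - f x -
     h 0 j / t j * (f (x + t j *: delta_mx 0 j) - f x))); last first.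
  by rewrite [X in _ = _ + X]sumrB addrA subrK.
apply: le_trans (cabs_le2 H1 H2) _.
rewrite -mulrDr le_eqVlt; apply/orP; left; apply/eqP; congr (_ * _).
by field; rewrite gt_eqF.
Qed.

End Increments.

(** * A discrete Cauchy formula *)

Section DiscreteCauchy.
Context {R : realType} {d : nat}.
Context (a : cspace R d) (s M : R) (f : cspace R d -> cplx R).
Context (s0 : 0 < s) (fM : tame a s f M).
Context (N : nat) (N1 : (1 < N)%N) (w : cplx R) (wprim : N.-primitive_root w).
Local Notation r := (s / 8).
Local Notation grid := {ffun 'I_d -> 'I_N}.
Implicit Types (z : cspace R d) (k : grid).

(** The grid is taken on the torus of radius s / 8 around a, well inside the
    polydisc, to leave room for the increments used in the expansion of f. *)
Definition node k : cspace R d := \row_j (a 0 j + r%:C%C * w ^+ k j).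

Definition mean (F : grid -> cplx R) : cplx R := (N ^ d)%:R^-1 * \sum_k F k.

(** The truncated geometric series of the Cauchy kernel
    zeta / (zeta - (z_j - a_j)), where zeta is the grid point of index m. The
    truncation makes the average over the grid exactly 1 and yields polynomials
    in z. *)
Definition kernel z (j : 'I_d) (m : nat) : cplx R :=
  \sum_(q < N) ((z 0 j - a 0 j) / (r%:C%C * w ^+ m)) ^+ q.

Definition weight z k : cplx R := \prod_j kernel z j (k j).

(** The next grid point on the j-th circle. *)
Definition shift (j : 'I_d) k : grid :=
  [ffun i => if i == j then ordS (k i) else k i].

Let r0 : 0 < r. Proof. by rewrite divr_gt0. Qed.
Let M0 : 0 <= M. Proof. exact: tame_ge0 fM. Qed.
Let N0 : (0 < N)%N. Proof. exact: ltnW. Qed.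
Let Nd0 : (N ^ d)%:R != 0 :> cplx R.
Proof. by rewrite pnatr_eq0 expn_eq0 negb_and -lt0n N0. Qed.
Let rC0 : r%:C%C != 0 :> cplx R.
Proof. by rewrite -cabs_eq0 cabs_real normr_eq0 gt_eqF. Qed.

Lemma cabs_w : cabs w = 1.
Proof.
apply/eqP; rewrite -(@pexpr_eq1 _ _ N) ?cabs_ge0//; apply/eqP.
by rewrite -cabsX (prim_expr_order wprim) cabs1.
Qed.

Let wN0 m : w ^+ m != 0.
Proof. by rewrite -cabs_eq0 cabsX cabs_w expr1n oner_eq0. Qed.

Let w1 : w - 1 != 0.
Proof.
rewrite subr_eq0; apply/eqP => w1.
have := prim_order_dvd wprim 1; rewrite expr1 w1 eqxx dvdn1 => /eqP N1'.
by move: N1; rewrite N1'.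
Qed.

Lemma shift_inj j : injective (shift j).
Proof.
move=> k l /ffunP E; apply/ffunP => i; have := E i; rewrite !ffunE.
by case: eqP => // _; exact: ordS_inj.
Qed.

Lemma w_ordS (i : 'I_N) : w ^+ ordS i = w * w ^+ i.
Proof. by rewrite /= (prim_expr_mod wprim) exprS. Qed.

Lemma meanB F G : mean F - mean G = mean (fun k => F k - G k).
Proof. by rewrite /mean sumrB mulrBr. Qed.

Lemma cabs_mean F b : (forall k, cabs (F k) <= b) -> cabs (mean F) <= b.
Proof.
move=> Fb; rewrite cabsM cabsV cabs_nat mulrC ler_pdivrMr; last first.
  by rewrite ltr0n expn_gt0 N0.
apply: le_trans (cabs_sum _ _ _) _.
apply: (@le_trans _ _ (\sum_(k : grid) b)); first exact: ler_sum.
by rewrite sumr_const card_ffun !card_ord mulr_natr.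
Qed.

(** Only the constant terms of the kernels survive, because the positive
    powers of w below N average to 0. *)
Lemma mean_weight z : mean (weight z) = 1.
Proof.
rewrite /mean /weight -(bigA_distr_bigA (fun j (m : 'I_N) => kernel z j m))/=.
have E j : \sum_(m < N) kernel z j m = N%:R.
  rewrite /kernel exchange_big/=.
  rewrite (bigD1 (Ordinal N0))//= [X in X + _](_ : _ = N%:R); last first.
    by under eq_bigr do rewrite expr0; rewrite sumr_const card_ord.
  rewrite big1 ?addr0// => q q0.
  have wq : w ^- q - 1 != 0.
    rewrite subr_eq0 invr_eq1 -(prim_order_dvd wprim) gtnNdvd//.
    by rewrite lt0n; apply: contra q0 => /eqP q0; apply/eqP/val_inj.
  apply: (mulfI wq); rewrite mulr0.
  under eq_bigr do rewrite invfM mulrA exprMn exprVn -exprM mulnC exprM -exprVn.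
  rewrite -mulr_sumr mulrCA -subrX1 -!exprVn -exprM mulnC exprM exprVn.
  by rewrite (prim_expr_order wprim) invr1 expr1n subrr mulr0.
rewrite (eq_bigr (fun=> N%:R)); last by move=> j _; exact: E.
by rewrite prodr_const cardT size_enum_ord -natrX mulVf.
Qed.

Context (z : cspace R d) (za : forall j, cabs (z 0 j - a 0 j) <= r / 2).

Lemma cabs_ratio j m : cabs ((z 0 j - a 0 j) / (r%:C%C * w ^+ m)) <= 2^-1.
Proof.
rewrite cabsM cabsV cabsM cabs_real gtr0_norm// cabsX cabs_w expr1n mulr1.
by rewrite ler_pdivrMr//; have := za j; lra.
Qed.

Lemma cabs_kernel j m : cabs (kernel z j m) <= 2.
Proof.
apply: le_trans (cabs_sum _ _ _) _.
apply: (@le_trans _ _ (\sum_(q < N) (2^-1 : R) ^+ q)).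
  by apply: ler_sum => q _; rewrite cabsX lerXn2r ?nnegrE ?cabs_ge0 ?cabs_ratio.
have : 0 <= (2^-1 : R) ^+ N by exact: exprn_ge0.
rewrite sum_half; lra.
Qed.

Lemma cabs_weight k : cabs (weight z k) <= 2 ^+ d.
Proof.
apply: (@le_trans _ _ (\prod_(j < d) 2)); last first.
  by rewrite prodr_const cardT size_enum_ord.
rewrite cabs_prod; apply: ler_prod => j _.
by rewrite cabs_ge0 cabs_kernel.
Qed.

(** The factor zeta - (z_j - a_j) cancels the pole of the Cauchy kernel; what
    is left depends on the grid point only through a factor zeta, since zeta^N
    is the same at all grid points. *)
Lemma kernel_pole j m : (r%:C%C * w ^+ m - (z 0 j - a 0 j)) * kernel z j m =
  r%:C%C * w ^+ m * (1 - ((z 0 j - a 0 j) / r%:C%C) ^+ N).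
Proof.
set u := z 0 j - a 0 j; set c := r%:C%C * w ^+ m.
have c0 : c != 0 by rewrite mulf_neq0.
have -> : (u / r%:C%C) ^+ N = (u / c) ^+ N.
  rewrite /c invfM mulrA [RHS]exprMn exprVn -exprM mulnC exprM.
  by rewrite (prim_expr_order wprim) expr1n invr1 mulr1.
rewrite -[1 - _]opprB subrX1 /kernel -/u -/c mulrN mulrA -mulNr; congr (_ * _).
by field.
Qed.

(** For l = 1 this is the interpolating polynomial at z, for l = 0 it is f z;
    in between, the grid lies on the torus contracted towards z. *)
Definition deform (l : R) : cplx R :=
  mean (fun k => f (z + l%:C%C *: (node k - z)) * weight z k).

Lemma deform0 : deform 0 = f z.
Proof.
rewrite /deform /mean; under eq_bigr do rewrite scale0r addr0.
by rewrite -mulr_sumr mulrCA -/(mean (weight z)) mean_weight mulr1.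
Qed.

Let nodeE k j : (node k - z) 0 j = r%:C%C * w ^+ k j - (z 0 j - a 0 j).
Proof. by rewrite !mxE; ring. Qed.

Lemma cabs_node k j : cabs ((node k - z) 0 j) <= 2 * r.
Proof.
rewrite nodeE; apply: (@le_trans _ _ (r + r / 2)); last by have := r0; lra.
apply: cabs_le2; last by rewrite cabsN.
by rewrite cabsM cabs_real gtr0_norm// cabsX cabs_w expr1n mulr1.
Qed.

Lemma deform_inside l k j : 0 <= l <= 1 ->
  cabs ((z + l%:C%C *: (node k - z)) 0 j - a 0 j) <= r.
Proof.
move=> /andP[l0 l1].
have -> : (z + l%:C%C *: (node k - z)) 0 j - a 0 j =
    (1 - l)%:C%C * (z 0 j - a 0 j) + l%:C%C * (r%:C%C * w ^+ k j).
  by rewrite 2!mxE nodeE rmorphB; ring.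
apply: (@le_trans _ _ ((1 - l) * (r / 2) + l * r)).
  apply: cabs_le2; apply: cabs_leM => //.
  - by rewrite cabs_real ger0_norm// subr_ge0.
  - by rewrite cabs_real ger0_norm.
  - by rewrite cabsM cabs_real gtr0_norm// cabsX cabs_w expr1n mulr1.
have : 0 <= (1 - l) * r by rewrite mulr_ge0 ?(ltW r0)// subr_ge0.
lra.
Qed.

Lemma deform_start l : 0 <= l <= 1 ->
  cabs (deform l - deform 0) <= 2 ^+ d * M * l.
Proof.
move=> l01; have /andP[l0 l1] := l01; rewrite meanB; apply: cabs_mean => k.
rewrite -mulrBl mulrC -mulrA; apply: cabs_leM; first exact: cabs_weight.
have [_ f1 _] := (tameP _ _ _ _).1 fM.
rewrite scale0r addr0.
have rs : r < s by rewrite ltr_pdivrMr// ltr_pMr// ltr1n.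
have inl l' : 0 <= l' <= 1 -> polydisc a s (z + l'%:C%C *: (node k - z)).
  by move=> l1' j; apply: le_lt_trans rs; exact: deform_inside.
have zin : polydisc a s z.
  have := inl 0; rewrite scale0r addr0 lexx ler01; exact.
have nu0 : 0 <= l * (2 * r) by rewrite mulr_ge0// mulr_ge0// ltW.
apply: le_trans (f1 _ _ _ nu0 (inl _ l01) zin _) _.
  move=> j; rewrite mxE addrAC subrr add0r mxE; apply: cabs_leM (cabs_node k j).
  by rewrite cabs_real ger0_norm.
rewrite ler_wpM2l// ler_pdivrMr//.
have : 0 <= l * s by rewrite mulr_ge0// ltW.
lra.
Qed.

Local Notation eps := (cabs (w - 1)).

(** The increment of the deformed average is expanded with the steps that
    lead from one grid point to the next on each circle. These steps are
    proportional to the grid point relative to the center, so by [kernel_pole]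
    the coefficient of such a step is constant along its circle, and the
    first-order part sums to 0 around it. *)
Lemma deform_step l e : 0 < l -> 0 <= e -> l + e <= 1 ->
  cabs (deform (l + e) - deform l) <= 2 ^+ d * (d%:R * M * (e * (e + eps))).
Proof.
move=> l0 e0 le1.
pose x k := z + l%:C%C *: (node k - z).
pose h k := e%:C%C *: (node k - z).
pose t k j := l%:C%C * (r%:C%C * w ^+ k j) * (w - 1).
have lC0 : l%:C%C != 0 :> cplx R.
  by rewrite -cabs_eq0 cabs_real normr_eq0 gt_eqF.
have t0 k j : t k j != 0 by rewrite !mulf_neq0.
have l01 : 0 <= l <= 1 by apply/andP; split; lra.
have eps2 : eps <= 2.
  by have := cabsD w (- 1); rewrite cabsN cabs1 cabs_w; lra.
have eps0 := cabs_ge0 (w - 1).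
have xS k j : x k + t k j *: delta_mx 0 j = x (shift j k).
  apply/rowP => i; rewrite !mxE eqxx/= ffunE; case: eqP => [->|_].
    by rewrite mulr1 w_ordS /t; ring.
  by rewrite mulr0 addr0.
pose V k j := weight z k * (h k 0 j / t k j).
have VS k j : V (shift j k) j = V k j.
  have VE k' : V k' j = (\prod_(i | i != j) kernel z i (k' i)) *
      (e%:C%C * (1 - ((z 0 j - a 0 j) / r%:C%C) ^+ N) / (l%:C%C * (w - 1))).
    rewrite /V /weight (bigD1 j)//= /h mxE nodeE /t.
    have := kernel_pole j (k' j).
    have : r%:C%C * w ^+ k' j != 0 by rewrite mulf_neq0.
    move: (r%:C%C * w ^+ k' j) (z 0 j - a 0 j) (_ ^+ N) => c u q c0 E.
    move: (\prod_(i | _) _) => P.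
    transitivity ((c - u) * kernel z j (k' j) *
      (P * e%:C%C / (l%:C%C * c * (w - 1)))).
      by ring.
    by rewrite E; field; rewrite w1 c0 lC0.
  rewrite !VE; congr (_ * _); apply: eq_bigr => i ij; rewrite ffunE.
  by rewrite (negbTE ij).
(* Summation around the j-th circle, a discrete closed-contour integral. *)
have cancel j : \sum_k V k j * (f (x k + t k j *: delta_mx 0 j) - f (x k)) = 0.
  under eq_bigr do rewrite xS mulrBr.
  rewrite sumrB; apply/eqP; rewrite subr_eq0; apply/eqP.
  rewrite [RHS](reindex_inj (@shift_inj j))/=.
  by apply: eq_bigr => k _; rewrite VS.
have main : mean (fun k => weight z k *
    \sum_j h k 0 j / t k j * (f (x k + t k j *: delta_mx 0 j) - f (x k))) = 0.
  rewrite /mean (eq_bigr (fun k =>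
    \sum_j V k j * (f (x k + t k j *: delta_mx 0 j) - f (x k)))).
    by rewrite exchange_big/= big1 ?mulr0.
  by move=> k _; rewrite mulr_sumr; apply: eq_bigr => j _; rewrite mulrA.
rewrite meanB -[mean _]subr0 -main meanB; apply: cabs_mean => k.
have -> : z + (l + e)%:C%C *: (node k - z) = x k + h k.
  by rewrite rmorphD scalerDl addrA.
rewrite -mulrBl [X in X - _]mulrC -mulrBr; apply: cabs_leM; first exact: cabs_weight.
apply: le_trans (tangent_difference s0 fM (rho := r) (eta := e * (2 * r))
  (tau := r * eps) _ _ _ _ _ _ _) _ => //.
- by rewrite mulr_ge0// mulr_ge0// ltW.
- have : e * r <= 1 * r by rewrite ler_wpM2r ?(ltW r0)//; lra.
  have := s0; lra.
- have : r * eps <= r * 2 by rewrite ler_wpM2l ?(ltW r0).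
  have := s0; lra.
- by move=> j; exact: deform_inside.
- move=> j; rewrite mxE; apply: cabs_leM (cabs_node k j).
  by rewrite cabs_real ger0_norm.
- move=> j; apply: cabs_leM => //; rewrite -[leRHS]mul1r; apply: cabs_leM.
    by rewrite cabs_real gtr0_norm//; case/andP: l01.
  by rewrite cabsM cabs_real gtr0_norm// cabsX cabs_w expr1n mulr1.
rewrite -[leRHS]mulrA ler_wpM2l// -[leLHS]mulrA ler_wpM2l//.
have -> : (s ^+ 2)^-1 * (e * (2 * r) * (4 * (e * (2 * r)) + r * eps)) =
   e * (e / 4 + eps / 32).
  by field; rewrite gt_eqF.
by rewrite ler_wpM2l//; lra.
Qed.

(** The deformation is performed in m equal steps. The first one starts at
    l = 0, where all grid points coincide with z, and is estimated by the
    Lipschitz bound. *)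
Lemma deform_bound m : (0 < m)%N ->
  cabs (deform 1 - f z) <= 2 ^+ d * M * (d%:R + 1) * (m%:R^-1 + eps).
Proof.
move=> m0; set e : R := m%:R^-1.
have e0 : 0 < e by rewrite invr_gt0 ltr0n.
have me : m%:R * e = 1 by rewrite mulfV// pnatr_eq0 -lt0n.
have eps0 := cabs_ge0 (w - 1).
have D0 : 0 <= 2 ^+ d * M by rewrite mulr_ge0// exprn_ge0.
have step i : (i < m)%N -> cabs (deform (i.+1%:R * e) - deform 0) <=
    2 ^+ d * M * e + i%:R * (2 ^+ d * (d%:R * M * (e * (e + eps)))).
  elim: i => [|i IH] im.
    rewrite mul0r addr0 mul1r; apply: deform_start.
    rewrite ltW//= -me ler_peMl ?(ltW e0)// ler1n //.
  have {}IH := IH (ltnW im).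
  rewrite -(subrK (deform (i.+1%:R * e)) (deform (i.+2%:R * e))) -addrA.
  set B := 2 ^+ d * (_ * _) in IH *.
  rewrite [leRHS](_ : _ = B + (2 ^+ d * M * e + i%:R * B)); last first.
    by rewrite -[i.+1%:R]natr1; ring.
  apply: cabs_le2 => //.
  rewrite -[i.+2%:R]natr1 mulrDl mul1r; apply: deform_step.
  - by rewrite mulr_gt0// ltr0n.
  - exact: ltW.
  - have : i.+2%:R * e <= m%:R * e by rewrite ler_pM2r// ler_nat.
    by rewrite me -[i.+2%:R]natr1 mulrDl mul1r.
rewrite -deform0; have := step m.-1; rewrite prednK// leqnn => /(_ isT).
rewrite me => /le_trans; apply.
have ei : e * (e + eps) * (m.-1)%:R <= e + eps.
  rewrite mulrAC ler_piMl//; first by rewrite addr_ge0// ltW.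
  have : (m.-1)%:R * e <= m%:R * e by rewrite ler_pM2r// ler_nat leq_pred.
  by rewrite me mulrC.
set T := e + eps in ei *.
apply: (@le_trans _ _ (2 ^+ d * M * T + 2 ^+ d * M * d%:R * T)); last first.
  by rewrite le_eqVlt; apply/orP; left; apply/eqP; ring.
apply: lerD; first by rewrite ler_wpM2l// /T; lra.
rewrite (_ : _ * _ = 2 ^+ d * M * d%:R * (e * T * (m.-1)%:R)); last by ring.
by rewrite ler_wpM2l// mulr_ge0.
Qed.

Lemma deform1_close : cabs (deform 1 - f z) <= 2 ^+ d * M * (d%:R + 1) * eps.
Proof.
set D := 2 ^+ d * M * (d%:R + 1).
have D0 : 0 <= D by rewrite mulr_ge0 ?addr_ge0// mulr_ge0// exprn_ge0.
apply/ler_addgt0Pl => e e0.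
pose m := (Num.bound (D / e)).+1.
apply: le_trans (deform_bound (m := m) _) _ => //.
rewrite -/D mulrDr lerD2r ler_pdivrMr// mulrC -ler_pdivrMr//.
apply/ltW; apply: lt_trans (archi_boundP _) _; first by rewrite divr_ge0// ltW.
by rewrite ltr_nat.
Qed.

End DiscreteCauchy.

(** * Tame functions are analytic *)

Section Roots.
Context {R : realType}.

(** Repeated square roots of -1. Of the two square roots v of w, the one
    nearer to 1 satisfies |v + 1|^2 >= 2 by the parallelogram law, and
    (v - 1) (v + 1) = w - 1. *)
Lemma root_near1 n : exists w : cplx R,
  w ^+ (2 ^ n) = -1 /\ cabs (w - 1) ^+ 2 <= 4 / 2 ^+ n.
Proof.
elim: n => [|n [w [wn w1]]].
  exists (-1); split; first by rewrite expr1.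
  rewrite -opprD cabsN (_ : 1 + 1 = 2%:R) ?cabs_nat; last by ring.
  by rewrite expr0 divr1; lra.
have [v vw v1] : exists2 v : cplx R, v ^+ 2 = w & cabs (v - 1) <= cabs (v + 1).
  have vw : sqrtC w ^+ 2 = w by exact: sqrtCK.
  have [H|/ltW H] := leP (cabs (sqrtC w - 1)) (cabs (sqrtC w + 1)).
    by exists (sqrtC w).
  exists (- sqrtC w); first by rewrite sqrrN.
  by rewrite -opprD cabsN [X in _ <= cabs X]addrC [leRHS]cabsB.
exists v; split; first by rewrite expnS exprM vw.
have vabs : cabs v = 1.
  apply/eqP; rewrite -(@pexpr_eq1 _ _ (2 ^ n.+1)) ?cabs_ge0 ?expn_gt0//.
  by rewrite -cabsX expnS exprM vw wn cabsN cabs1.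
have par : cabs (v - 1) ^+ 2 + cabs (v + 1) ^+ 2 = 4.
  apply: complexI; rewrite rmorphD/= !rmorphXn/= -!cabsE !normCK.
  rewrite !rmorphB !rmorphD !rmorph1.
  have := normCK v; rewrite cabsE vabs expr1n => E.
  transitivity (2 * (v * Num.conj v) + 2); first by ring.
  by rewrite -E; ring.
have prod : cabs (v - 1) ^+ 2 * cabs (v + 1) ^+ 2 = cabs (w - 1) ^+ 2.
  by rewrite -exprMn -cabsM -vw; congr (cabs _ ^+ 2); ring.
have sq : cabs (v - 1) ^+ 2 <= cabs (v + 1) ^+ 2.
  by rewrite ler_sqr ?nnegrE ?cabs_ge0.
have p2 : 2 <= cabs (v + 1) ^+ 2 by lra.
rewrite [2 ^+ n.+1]exprS invfM mulrCA ler_pdivlMl//.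
by apply: le_trans w1; rewrite -prod mulrC ler_wpM2l// sqr_ge0.
Qed.

Lemma prim_root_2 n (w : cplx R) : w ^+ (2 ^ n) = -1 ->
  (2 ^ n.+1).-primitive_root w.
Proof.
move=> wn.
have w2 : w ^+ (2 ^ n.+1) = 1 by rewrite expnS mulnC exprM wn sqrrN expr1n.
have [m mprim mdvd] := prim_order_exists (expn_gt0 2 n.+1) w2.
have /(dvdn_pfactor m n.+1 (isT : prime 2))[k kn mk] := mdvd.
move: kn; rewrite leq_eqVlt => /orP[/eqP <-|]; first by rewrite -mk.
rewrite ltnS => kn; have : (m %| 2 ^ n)%N by rewrite mk dvdn_exp2l.
rewrite (prim_order_dvd mprim) wn => /eqP /esym/eqP; rewrite -subr_eq0 opprK.
by rewrite -[_ + _]/(2%:R) pnatr_eq0.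
Qed.

End Roots.

Section TameAnalytic.
Context {R : realType} {d : nat}.
Implicit Types (a z : cspace R d).
Local Notation multi := {ffun 'I_d -> nat}.

(** The coefficients of the polynomial interpolating f on the grid. *)
Definition coefficient a (s : R) (f : cspace R d -> cplx R) (N : nat)
    (w : cplx R) (al : multi) : cplx R :=
  mean (fun k : {ffun 'I_d -> 'I_N} =>
    f (node a s w k) * \prod_j ((s / 8)%:C%C * w ^+ k j) ^- al j).

Lemma deform1_poly a s f N w z :
  @deform R d a s f N w z 1 =
  \sum_(al <- box N) coefficient a s f N w al * monomial al (z - a).
Proof.
rewrite /deform /coefficient /mean.
under [RHS]eq_bigr do rewrite -mulrA mulr_suml.
rewrite -mulr_sumr exchange_big/=; congr (_ * _); apply: eq_bigr => k _.
rewrite scale1r addrC subrK.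
under eq_bigr do rewrite -mulrA.
rewrite -mulr_sumr; congr (_ * _).
rewrite /weight /kernel -(sum_box (fun j q =>
  ((z 0 j - a 0 j) / ((s / 8)%:C%C * w ^+ k j)) ^+ q)).
apply: eq_bigr => al _; rewrite /monomial -big_split/=; apply: eq_bigr => j _.
by rewrite !mxE [LHS]exprMn exprVn mulrC.
Qed.

Lemma cabs_coefficient a s f M N w al : 0 < s -> tame a s f M -> (1 < N)%N ->
  cabs w = 1 ->
  cabs (coefficient a s f N w al) <= M * \prod_j (s / 8) ^- al j.
Proof.
move=> s0 fM N1 w1; have r0 : 0 < s / 8 by rewrite divr_gt0.
have nodes m : cabs ((s / 8)%:C%C * w ^+ m) = s / 8 :> R.
  by rewrite cabsM cabs_real gtr0_norm// cabsX w1 expr1n mulr1.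
apply: cabs_mean => // k; apply: cabs_leM.
  have [f0 _ _] := (tameP _ _ _ _).1 fM; apply: f0 => j.
  by rewrite mxE addrAC subrr add0r nodes ltr_pdivrMr// ltr_pMr// ltr1n.
rewrite cabs_prod le_eqVlt; apply/orP; left; apply/eqP.
by apply: eq_bigr => j _; rewrite cabsV cabsX nodes.
Qed.

Lemma ultra_fmap (S T : Type) (U : set_system S) (u : S -> T) :
  UltraFilter U -> UltraFilter (u @ U).
Proof.
move=> UU; split=> [|G GG UG]; first exact: fmap_proper_filter.
rewrite eqEsubset; split=> // A GA.
have [//|UnA] := in_ultra_setVsetC (u @^-1` A) UU.
have /(filterI GA) : G (~` A) by exact: UG.
by rewrite setICr => /filter_ex[].
Qed.

(** An ultrafilter gives limits of all coefficients at once, without any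
    diagonal extraction of subsequences. *)
Lemma bounded_ultra_limit (U : set_system nat) (UU : UltraFilter U)
    (u : nat -> cplx R) B :
  (forall n, cabs (u n) <= B) -> exists l : cplx R, u @ U --> l.
Proof.
move=> uB.
have part (v : nat -> R) : (forall n, `|v n| <= cabs (u n)) ->
    exists l : R, v @ U --> l.
  move=> vu; have vU := ultra_fmap v UU.
  have := @segment_compact R (- B) B; rewrite compact_ultra => /(_ _ vU)[].
    suff : \forall n \near U, `[- B, B]%classic (v n) by [].
    apply: filterE => n /=; rewrite in_itv/= -ler_norml.
    exact: le_trans (vu n) (uB n).
  by move=> l [_ vl]; exists l.
have reE x : cabs x = Num.sqrt (complex.Re x ^+ 2 + complex.Im x ^+ 2).
  by apply: complexI; rewrite -cabsE normc_def.
have [|p up] := part (fun n => complex.Re (u n)).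
  move=> n; rewrite reE -sqrtr_sqr ler_sqrt ?lerDl ?sqr_ge0//.
  by rewrite addr_ge0 ?sqr_ge0.
have [|q uq] := part (fun n => complex.Im (u n)).
  move=> n; rewrite reE -sqrtr_sqr ler_sqrt ?lerDr ?sqr_ge0//.
  by rewrite addr_ge0 ?sqr_ge0.
exists (p%:C%C + Complex 0 1 * q%:C%C : R[i]); apply/cvg_cabsP => e e0.
have e20 : 0 < e / 2 by rewrite divr_gt0.
move/cvgrPdist_lt: up => /(_ _ e20) up.
move/cvgrPdist_lt: uq => /(_ _ e20) uq.
apply: filterS (filterI up uq) => n [/= Hp Hq].
rewrite [u n]complexE.
rewrite (_ : _ - _ = (complex.Re (u n) - p)%:C%C +
    (Complex 0 1 : cplx R) * (complex.Im (u n) - q)%:C%C); last first.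
  by rewrite !rmorphB/=; ring.
apply: le_lt_trans (cabsD _ _) _; rewrite cabsM !cabs_real.
have -> : cabs (Complex 0 1 : cplx R) = 1.
  by rewrite reE/= expr0n add0r expr1n sqrtr1.
by rewrite mul1r (distrC _ p) (distrC _ q); lra.
Qed.

(** The tails of the multivariate geometric series of ratio 1 / 2 tend to 0:
    its partial sums over boxes are bounded, and the box m nearly attains their
    supremum. *)
Lemma half_tail (e : R) : 0 < e -> exists m, forall n,
  \sum_(al <- box n) \prod_j (2^-1 : R) ^+ (al : multi) j <=
  \sum_(al <- box m) \prod_j 2^-1 ^+ (al : multi) j + e.
Proof.
move=> e0.
pose X n : R := \sum_(al <- box n) \prod_j 2^-1 ^+ (al : multi) j.
have XB n : X n <= 2 ^+ d.
  rewrite /X (sum_box (fun _ q => 2^-1 ^+ q)) prodr_const cardT size_enum_ord.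
  have n0 : 0 <= (2^-1 : R) ^+ n by exact: exprn_ge0.
  have := sum_half (R := R) n => E.
  apply: lerXn2r; rewrite ?nnegrE//; last by rewrite E; lra.
  by apply: sumr_ge0 => i _; exact: exprn_ge0.
have XS : has_sup (range X).
  by split; [exists (X 0%N), 0%N|exists (2 ^+ d) => _ [n _ <-]].
have [_ [m _ <-] Hm] := sup_adherent e0 XS.
exists m => n; have : X n <= sup (range X) by apply: sup_upper_bound => //; exists n.
by rewrite -/(X n) -/(X m); lra.
Qed.

End TameAnalytic.

Section PowerSeries.
Context {R : realType} {d : nat}.
Implicit Types (a z : cspace R d).
Local Notation multi := {ffun 'I_d -> nat}.

(** The interpolating polynomials converge to f near a, and their terms are
    dominated by a fixed geometric series, so the series of the limit
    coefficients has the sum f. *)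
Lemma tame_analytic a s f M : 0 < s -> tame a s f M -> @analytic_at R d f a.
Proof.
move=> s0 fM; have M0 := tame_ge0 s0 fM.
have /choice[w Hw] n := @root_near1 R n.
pose N n := (2 ^ n.+1)%N.
have N1 n : (1 < N n)%N by rewrite -(expn0 2) ltn_exp2l.
have wp n : (N n).-primitive_root (w n) by apply: prim_root_2; have [] := Hw n.
have w1 n : cabs (w n) = 1 by exact: cabs_w (N1 n) _ (wp n).
have wto1 (e : R) : 0 < e -> \forall n \near \oo, cabs (w n - 1) < e.
  move=> e0; exists (Num.bound (4 / e ^+ 2)) => // n /= nb.
  rewrite -ltr_sqr ?nnegrE ?cabs_ge0 ?ltW//.
  apply: le_lt_trans (Hw n).2 _.
  rewrite ltr_pdivrMr ?exprn_gt0// mulrC -ltr_pdivrMr ?exprn_gt0//.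
  apply: lt_le_trans (archi_boundP _) _; first by rewrite divr_ge0// sqr_ge0.
  by rewrite -natrX ler_nat (leq_trans nb)// ltnW// ltn_expl.
have [U [UU oU]] := ultraFilterLemma eventually_filter.
pose C n al := coefficient a s f (N n) (w n) al.
have coefB n al : cabs (C n al) <= _ := cabs_coefficient al s0 fM (N1 n) (w1 n).
have /choice[c Hc] (al : multi) : exists l : cplx R, C ^~ al @ U --> l.
  by apply: bounded_ultra_limit => n; exact: coefB.
exists c; apply/nbhs_polydiscP; exists (s / 16); first by rewrite divr_gt0.
move=> z za; have zr j : cabs (z 0 j - a 0 j) <= s / 8 / 2.
  by have := za j; lra.
apply/cvg_cabsP => e e0; have e40 : 0 < e / 4 by rewrite divr_gt0.
pose A := 2 ^+ d * M * (d%:R + 1).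
have A0 : 0 <= A by rewrite mulr_ge0 ?addr_ge0// mulr_ge0// exprn_ge0.
have eM0 : 0 < e / 4 / (M + 1) by rewrite divr_gt0// ltr_wpDl.
(* The terms of every interpolating polynomial at z are dominated by M times
   a geometric series of ratio 1 / 2, so that beyond the box m they are
   negligible uniformly in n. *)
have [m Hm] := @half_tail R d _ eM0.
exists (box m) => // F /= mF; rewrite partial_sumE.
pose S n (G : {fset multi}) := \sum_(al <- G) C n al * monomial al (z - a).
have limF : S ^~ F @ U --> \sum_(al <- F) c al * monomial al (z - a).
  by apply: cvg_big => [|al _]; [exact: add_continuous|exact: cvgMr_tmp].
have [k Fk] := fset_sub_box F.
have [n [[/= kn wn] Fn]] : exists n,
    ((k <= n)%N /\ A * cabs (w n - 1) < e / 4) /\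
    cabs (S n F - \sum_(al <- F) c al * monomial al (z - a)) < e / 4.
  move/cvg_cabsP: limF => /(_ _ e40) limF.
  have near1 : \forall n \near U, cabs (w n - 1) < e / 4 / (A + 1).
    by apply: oU; apply: wto1; rewrite divr_gt0// ltr_wpDl.
  have neark : \forall n \near U, (k <= n)%N by apply: oU; exists k.
  have UP : ProperFilter U by exact: ultra_proper.
  have [n [[/= H1 H2] H3]] :=
    @filter_ex _ U UP _
      (@filterI _ U _ _ _ (@filterI _ U _ _ _ neark near1) limF).
  exists n; split=> //; split=> //; move: H2; rewrite ltr_pdivlMr ?ltr_wpDl//.
  by have := cabs_ge0 (w n - 1); lra.
have FN : (F `<=` box (N n))%fset.
  apply: fsubset_trans Fk (boxS _); apply: leq_trans kn _.
  by apply/ltnW; apply: ltn_trans (ltn_expl n (isT : 1 < 2)%N) _; rewrite ltn_exp2l.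
have close : cabs (S n (box (N n)) - f z) < e / 4.
  rewrite /S -deform1_poly; apply: le_lt_trans wn.
  exact: (deform1_close s0 fM (N1 n) (wp n) zr).
pose T := \sum_(al <- (box (N n) `\` F)%fset) C n al * monomial al (z - a).
have tail : cabs T <= e / 4.
  apply: le_trans (cabs_sum _ _ _) _.
  apply: (@le_trans _ _ (M * \sum_(al <- (box (N n) `\` F)%fset)
      \prod_j 2^-1 ^+ (al : multi) j)).
    rewrite mulr_sumr; apply: ler_sum => al _.
    have -> : \prod_j 2^-1 ^+ al j =
        (\prod_j (s / 8) ^- al j) * (\prod_j (s / 8 / 2) ^+ al j) :> R.
      rewrite -big_split/=; apply: eq_bigr => j _.
      by rewrite -exprVn -exprMn; congr (_ ^+ _); field; rewrite gt_eqF.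
    rewrite mulrA; apply: cabs_leM; first exact: coefB.
    rewrite cabs_prod; apply: ler_prod => j _.
    rewrite cabsX exprn_ge0 ?cabs_ge0//= !mxE.
    by apply: lerXn2r; rewrite ?nnegrE ?cabs_ge0// (le_trans _ (zr j))// cabs_ge0.
  have w0 (al : multi) : 0 <= \prod_j (2^-1 : R) ^+ al j.
    by apply: prodr_ge0 => j _; exact: exprn_ge0.
  have := Hm (N n); rewrite (sum_fset_split _ FN) (sum_fset_split _ mF).
  set t := \sum_(al <- (box (N n) `\` F)%fset) _.
  have : 0 <= \sum_(al <- (F `\` box m)%fset) \prod_j (2^-1 : R) ^+ (al : multi) j.
    by apply: sumr_ge0 => al _; exact: w0.
  have t0 : 0 <= t by apply: sumr_ge0 => al _; exact: w0.
  move=> P Q; have : t <= e / 4 / (M + 1) by lra.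
  by rewrite ler_pdivlMr ?ltr_wpDl//; lra.
rewrite (_ : _ - _ = - (S n F - \sum_(al <- F) c al * monomial al (z - a))
   + (- T + (S n (box (N n)) - f z))); last first.
  by rewrite {2}/S (sum_fset_split _ FN) -/(S n F) -/T; ring.
apply: le_lt_trans (cabsD _ _) _; have := cabsD (- T) (S n (box (N n)) - f z).
by rewrite !cabsN; lra.
Qed.

End PowerSeries.

(** * Uniform tameness in the Hilbert space *)

Section HilbertNorm.
Context {R : realType} {V : normedModType (cplx R)}.
Implicit Types u v : V.

Definition hnorm v : R := complex.Re `|v|.

Lemma hnormE v : `|v| = (hnorm v)%:C%C.
Proof. by rewrite /hnorm (RRe_real (normr_real v)). Qed.

Lemma hnorm_ge0 v : 0 <= hnorm v.
Proof. by rewrite -ler0c -hnormE. Qed.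

Lemma hnormD u v : hnorm (u + v) <= hnorm u + hnorm v.
Proof. by rewrite -lecR rmorphD/= -!hnormE ler_normD. Qed.

Lemma hnormN v : hnorm (- v) = hnorm v.
Proof. by rewrite /hnorm normrN. Qed.

Lemma hnormZ (k : cplx R) v : hnorm (k *: v) = cabs k * hnorm v.
Proof. by apply: complexI; rewrite rmorphM/= -!hnormE -cabsE normrZ. Qed.

Lemma hnorm_eq0 v : (hnorm v == 0) = (v == 0).
Proof. by rewrite -[RHS]normr_eq0 hnormE -(inj_eq (@complexI R)). Qed.

End HilbertNorm.

(** Completeness in the form of Cantor: the next ball lies in the previous
    one because its center moves by at most half the radius and its radius is at
    most halved. *)
Lemma nested_balls (R : realType) (V : completeNormedModType (cplx R))
    (x : nat -> V) (r : nat -> R) :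
  (forall n, 0 < r n) -> (forall n, r n.+1 <= r n / 2) ->
  (forall n, hnorm (x n.+1 - x n) <= r n / 2) ->
  exists l, forall n, hnorm (l - x n) <= r n.
Proof.
move=> r0 rS xS.
have near m n : hnorm (x (n + m)%N - x n) + r (n + m)%N <= r n.
  elim: m => [|m IH]; first by rewrite addn0 subrr /hnorm normr0/= add0r.
  rewrite addnS; have := rS (n + m)%N; have := xS (n + m)%N.
  have := hnormD (x (n + m).+1 - x (n + m)%N) (x (n + m)%N - x n).
  by rewrite addrA subrK; lra.
have small n : r n <= r 0 / n.+1%:R.
  elim: n => [|n IH]; first by rewrite divr1.
  apply: le_trans (rS n) _; rewrite ler_pdivrMr//; apply: le_trans IH _.
  rewrite -mulrA ler_wpM2l ?(ltW (r0 0))//.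
  by rewrite ler_pdivlMl// ler_pdivrMr// -natrM ler_nat mul2n -addnn addnS ltnS
    leq_addr.
have arch (e : R) : 0 < e -> exists n, r n < e.
  move=> e0; exists (Num.bound (r 0 / e)).
  apply: le_lt_trans (small _) _.
  rewrite ltr_pdivrMr// mulrC -ltr_pdivrMr//.
  apply: lt_trans (archi_boundP _) _; first by rewrite divr_ge0// ltW.
  by rewrite ltr_nat.
have : cvg (x @ \oo).
  apply: cauchy_cvg; apply: cauchy_exP => e e0.
  have er : e = (complex.Re e)%:C%C by rewrite RRe_real// gtr0_real.
  move: e0; rewrite er ltr0C => e0.
  have [n rn] := arch _ e0.
  exists (x n); exists n => // m /= nm; rewrite -ball_normE/= hnormE ltcR.
  rewrite -hnormN opprB -(subnKC nm); apply: le_lt_trans rn.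
  by have := near (m - n)%N n; have := r0 (n + (m - n))%N; lra.
move=> /cvg_ex[l /cvgrPdist_lt xl]; exists l => n.
apply/ler_addgt0Pl => e e0.
have [|N _ HN] := xl e%:C%C; first by rewrite ltr0C.
have := HN (n + N)%N (leq_addl _ _); rewrite /= hnormE ltcR => lx.
have := hnormD (l - x (n + N)%N) (x (n + N)%N - x n); rewrite addrA subrK.
by have := near N n; have := r0 (n + N)%N; lra.
Qed.

Section UniformTame.
Context {R : realType} {d : nat} (Omega : set (cspace R d)) (H : rkhs Omega).
Implicit Types (a : cspace R d) (f : H).

Definition combination (c : 'I_3 -> cplx R) (p : 'I_3 -> cspace R d)
    (f : cspace R d -> cplx R) : cplx R := \sum_i c i * f (p i).

Section Combination.
Context (c : 'I_3 -> cplx R) (p : 'I_3 -> cspace R d) (Op : forall i, Omega (p i)).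
Local Notation L f := (combination c p (rkhs_eval f)).

Lemma combination_linear (k : cplx R) f g : L (k *: f + g) = k * L f + L g.
Proof.
rewrite /combination mulr_sumr -big_split/=; apply: eq_bigr => i _.
by rewrite rkhs_eval_linear// mulrDr mulrCA.
Qed.

Lemma combinationD f g : L (f + g) = L f + L g.
Proof. by have := combination_linear 1 f g; rewrite scale1r mul1r. Qed.

Lemma combination0 : L (0 : H) = 0.
Proof. by apply: (addrI (L (0 : H))); rewrite -combinationD !addr0. Qed.

Lemma combinationZ k f : L (k *: f) = k * L f.
Proof. by have := combination_linear k f (0 : H); rewrite combination0 !addr0. Qed.

Lemma combinationB f g : L (f - g) = L f - L g.
Proof. by rewrite combinationD -scaleN1r combinationZ mulN1r. Qed.

Lemma combination_bounded : exists2 K, 0 <= K & forall f, cabs (L f) <= K * hnorm f.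
Proof.
have /choice[M HM] i : exists M : R, 0 <= M /\ forall f,
    cabs (rkhs_eval f (p i)) <= M * hnorm f.
  have [M HM] := rkhs_eval_bounded H (Op i).
  exists (cabs M); split=> [|f]; first exact: cabs_ge0.
  rewrite -lecR -cabsE rmorphM/= -hnormE -cabsE; apply: le_trans (HM f) _.
  have : 0 <= M * `|f| by apply: le_trans (HM f).
  by move/ger0_norm => <-; rewrite normrM normr_id.
exists (\sum_i cabs (c i) * M i).
  by apply: sumr_ge0 => i _; rewrite mulr_ge0 ?cabs_ge0//; have [] := HM i.
move=> f; apply: le_trans (cabs_sum _ _ _) _.
rewrite mulr_suml; apply: ler_sum => i _; rewrite -mulrA.
by apply: cabs_leM => //; have [_] := HM i; apply.
Qed.

End Combination.

(** The principle of uniform boundedness, with a polydisc that also depends on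
    f. If uniformity fails, then for each n every ball of H contains a smaller
    ball on which some difference on the polydisc of radius s0 / (n + 1) exceeds
    n times its size. A common point of nested such balls would not be tame near
    a. *)
Lemma tame_uniform a (s0 : R) : 0 < s0 -> polydisc a s0 `<=` Omega ->
  (forall f, exists2 s, 0 < s & exists M, tame a s (rkhs_eval f) M) ->
  exists2 s, 0 < s <= s0 &
    exists2 M, 0 <= M & forall f, tame a s (rkhs_eval f) (M * hnorm f).
Proof.
move=> s00 aO ptame; pose s n : R := s0 / n.+1%:R.
have sgt0 n : 0 < s n by rewrite divr_gt0.
have sle m n : (m <= n)%N -> s n <= s m.
  by move=> mn; rewrite ler_wpM2l ?(ltW s00)// lef_pV2 ?posrE// ler_nat.
have sle0 n : s n <= s0 by rewrite -[leRHS]divr1; exact: (sle 0%N n).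
apply: contrapT => nuniform.
have bad n : exists f c p b, difference a (s n) c p b /\
    n%:R * hnorm f * b < cabs (combination c p (rkhs_eval f)).
  apply: contrapT => nbad; apply: nuniform.
  exists (s n); first by rewrite sgt0 sle0.
  exists n%:R => // f c p b D; rewrite leNgt; apply/negP => lt.
  by apply: nbad; exists f, c, p, b.
have step (q : nat * (H * {posnum R})) : exists y : H * {posnum R},
    [/\ y.2%:num <= q.2.2%:num / 2, hnorm (y.1 - q.2.1) <= q.2.2%:num / 2 &
     exists c p b, difference a (s q.1) c p b /\
       forall z, hnorm (z - y.1) <= y.2%:num ->
       q.1%:R * b < cabs (combination c p (rkhs_eval z))].
  case: q => n [x r] /=; set r2 := r%:num / 2.
  have r20 : 0 < r2 by rewrite divr_gt0.
  pose N := maxn n (Num.bound (n%:R / r2)).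
  have nN : n%:R <= r2 * N%:R.
    rewrite mulrC -ler_pdivrMr//; apply/ltW.
    apply: lt_le_trans (archi_boundP _) _; first by rewrite divr_ge0// ltW.
    by rewrite ler_nat leq_maxr.
  have [f [c [p [b [D Lf]]]]] := bad N.
  have [b' D' bb'] := difference_mono (sgt0 N) (sle _ _ (leq_maxl n _)) D.
  have Op i : Omega (p i).
    by apply: aO; apply: polydiscS (sle0 N) _ _; exact: difference_polydisc D.
  pose L (g : H) := combination c p (rkhs_eval g).
  have b0' := difference_ge0 (sgt0 n) D'.
  have b0 : 0 <= b by exact: le_trans bb'.
  have f0 : 0 < hnorm f.
    rewrite lt_neqAle hnorm_ge0 eq_sym hnorm_eq0 andbT; apply/eqP => f0.
    move: Lf; rewrite f0 [combination _ _ _](combination0 _ Op).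
    by rewrite /hnorm normr0/= mulr0 mul0r cabs0 ltxx.
  pose e : H := (r2 / hnorm f)%:C%C *: f.
  have he : hnorm e = r2.
    by rewrite hnormZ cabs_real gtr0_norm ?divr_gt0// divfK ?gt_eqF.
  have Le : n%:R * b' < cabs (L e).
    rewrite /L (combinationZ _ Op) cabsM cabs_real gtr0_norm ?divr_gt0//.
    rewrite mulrAC ltr_pdivlMr//.
    apply: le_lt_trans (_ : _ <= r2 * (N%:R * hnorm f * b)) _; last by rewrite ltr_pM2l.
    have -> : r2 * (N%:R * hnorm f * b) = r2 * N%:R * b * hnorm f by ring.
    rewrite ler_pM2r//; apply: ler_pM => //.
  (* Since L (x + e) - L (x - e) = 2 * L e, one of the two values is large. *)
  have [y hy Ly] : exists2 y, hnorm (y - x) <= r2 & n%:R * b' < cabs (L y).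
    have [xp|xp] := ltP (n%:R * b') (cabs (L (x + e))).
      by exists (x + e) => //; rewrite addrAC subrr add0r he.
    exists (x - e); first by rewrite addrAC subrr add0r hnormN he.
    have := cabsD (L (x + e)) (- L (x - e)); rewrite cabsN.
    rewrite /L !(combinationB _ Op, combinationD _ Op) in xp Le *.
    rewrite (_ : _ - (_ - _) = L e + L e); last by rewrite /L; ring.
    have -> : L e + L e = 2 * L e by ring.
    by rewrite cabsM cabs_nat /L; lra.
  have [K K0 HK] := combination_bounded c Op.
  set del := cabs (L y) - n%:R * b'; have del0 : 0 < del by rewrite subr_gt0.
  have K10 : 0 < K + 1 by lra.
  have rho0 : 0 < Num.min r2 (del / (2 * (K + 1))).
    by rewrite lt_min r20 divr_gt0// mulr_gt0.
  exists (y, PosNum rho0); split => //=; first by rewrite ge_min lexx.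
  exists c, p, b'; split=> // z zy.
  have := cabsD (L z) (L y - L z); rewrite addrC subrK cabsB /L -(combinationB _ Op).
  have := HK (z - y).
  have : K * hnorm (z - y) <= del / 2.
    apply: (@le_trans _ _ ((K + 1) * (del / (2 * (K + 1))))); last first.
      by rewrite le_eqVlt; apply/orP; left; apply/eqP; field; rewrite gt_eqF.
    apply: ler_pM => //; [exact: hnorm_ge0|lra|].
    by apply: le_trans zy _; rewrite ge_min lexx orbT.
  by move: del0; rewrite /del /L; lra.
have [next Hnext] := choice step.
pose fix x n := if n is m.+1 then next (m, x m) else (0 : H, PosNum (@ltr01 R)).
have Hx n := Hnext (n, x n).
have [l Hl] : exists l, forall n, hnorm (l - (x n).1) <= (x n).2%:num.
  by apply: nested_balls => // n; have [] := Hx n.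
have [t t0 [M fM]] := ptame l.
pose n := maxn (Num.bound M) (Num.bound (s0 / t)).
have [_ _ [c [p [b [D HD]]]]] := Hx n.
have M0 := tame_ge0 t0 fM.
have snt : s n <= t.
  rewrite ler_pdivrMr// mulrC -ler_pdivrMr//; apply/ltW.
  apply: lt_le_trans (archi_boundP _) _; first by rewrite divr_ge0// ltW.
  by rewrite ler_nat leqW// leq_maxr.
have [b' D' bb'] := difference_mono (sgt0 n) snt D.
have := HD l (Hl n.+1) => /=; apply/negP; rewrite -leNgt.
apply: le_trans (fM _ _ _ D') _.
apply: ler_pM => //; first exact: difference_ge0 D'.
apply/ltW; apply: lt_le_trans (archi_boundP M0) _.
by rewrite ler_nat leq_maxl.
Qed.

End UniformTame.

(** * Three-point multipliers preserve tameness *)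

Section Multiplier.
Context {R : realType} {d : nat} (Omega : set (cspace R d)) (H : rkhs Omega).
Context (K : cspace R d -> cspace R d -> cplx R)
  (K_kernel : reproducing_kernel H K).
Implicit Types (a : cspace R d) (f u : H).
Local Notation dot := (rkhs_dot H).

Lemma hnorm_dot f : dot f f = (hnorm f ^+ 2)%:C%C.
Proof. by rewrite rkhs_dot_norm hnormE rmorphXn. Qed.

Lemma cauchy_schwarz f u : cabs (dot f u) <= hnorm f * hnorm u.
Proof.
have [->|u0] := eqVneq u 0.
  by rewrite linear0r cabs0 mulr_ge0 ?hnorm_ge0.
have hu0 : 0 < hnorm u by rewrite lt_neqAle hnorm_ge0 eq_sym hnorm_eq0 u0.
have du0 : dot u u != 0.
  by rewrite hnorm_dot -[0]/(0%:C%C) (inj_eq (@complexI R)) expf_eq0/= gt_eqF.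
set t := dot f u / dot u u.
have wu : dot (f - t *: u) u = 0.
  by rewrite linearBl linearZl_LR/= /t divfK// subrr.
have : 0 <= dot (f - t *: u) (f - t *: u) by rewrite hnorm_dot ler0c sqr_ge0.
rewrite linearBr linearZr_LR/= wu mulr0 subr0 linearBl linearZl_LR/=.
rewrite [dot u f]hermC/= mul1r /t mulrAC -normCK cabsE !hnorm_dot.
rewrite -rmorphXn -fmorphV -rmorphM -rmorphB/= ler0c subr_ge0.
rewrite ler_pdivrMr ?exprn_gt0// -exprMn ler_sqr// nnegrE ?cabs_ge0//.
by rewrite mulr_ge0 ?hnorm_ge0.
Qed.

(** The Riesz representative of a finite combination of evaluations; its norm
    is the quadratic form of the kernel matrix. *)
Lemma representer (c : 'I_3 -> cplx R) (p : 'I_3 -> cspace R d) :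
  (forall i, Omega (p i)) -> exists u : H,
    (forall f, dot f u = combination c p (rkhs_eval f)) /\
    (hnorm u ^+ 2)%:C%C = \sum_i \sum_j c i * Num.conj (c j) * K (p i) (p j).
Proof.
move=> Op; have /choice[k Hk] i := K_kernel (Op i).
pose u := \sum_i Num.conj (c i) *: k i; exists u.
have dotu f : dot f u = combination c p (rkhs_eval f).
  rewrite linear_sumr; apply: eq_bigr => i _.
  by rewrite linearZr_LR/= conjCK -(Hk i).2.
split=> //; rewrite -hnorm_dot dotu; apply: eq_bigr => i _.
rewrite (Hk i).2 linear_sumlz mulr_sumr; apply: eq_bigr => j _.
by rewrite linearZl_LR/= -(Hk i).2 (Hk j).1// mulrA.
Qed.

(** Let u represent a difference, and w the same difference with the weights
    multiplied by the values of phi. Testing tameness on u itself gives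
    |u| <= M * b; the positivity of the 3 x 3 matrix is |w| <= C * |u|; and
    pairing f with w gives the difference of phi * f. *)
Lemma tame_multiplier a s (M C : R) (phi : cspace R d -> cplx R) :
  0 < s -> polydisc a s `<=` Omega -> 0 <= M -> 0 <= C ->
  (forall f, tame a s (rkhs_eval f) (M * hnorm f)) ->
  npoint_positive Omega 3
    (fun z w => K z w * ((C ^+ 2)%:C%C - phi z * (phi w)^*)) ->
  forall f, tame a s (fun x => phi x * rkhs_eval f x) (C * M * hnorm f).
Proof.
move=> s0 aO M0 C0 tm pos f c p b D.
have Op i : Omega (p i) by apply: aO; exact: difference_polydisc D.
have b0 := difference_ge0 s0 D.
have [u [du nu]] := representer c Op.
have [w [dw nw]] := representer (fun i => c i * phi (p i)) Op.
have uM : hnorm u <= M * b.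
  have := tm u c p b D; rewrite -/(combination c p (rkhs_eval u)) -du hnorm_dot.
  rewrite cabs_real ger0_norm ?sqr_ge0// expr2.
  have [u0|/eqP u0] := eqVneq (hnorm u) 0; first by rewrite u0 mulr_ge0.
  rewrite mulrAC ler_pM2r// lt_neqAle hnorm_ge0 eq_sym andbT; exact/eqP.
have wu : hnorm w <= C * hnorm u.
  rewrite -[leLHS]ger0_norm ?hnorm_ge0// -[leRHS]ger0_norm ?mulr_ge0 ?hnorm_ge0//.
  rewrite -ler_sqr ?nnegrE// !real_normK ?num_real// exprMn -subr_ge0 -ler0c.
  rewrite rmorphB [X in X - _]rmorphM/= nu nw.
  (* The quadratic form conjugates the entries on the left, and [representer]
     those on the right. *)
  have := pos p Op (\col_i Num.conj (c i)).
  congr (0 <= _); rewrite mxE.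
  rewrite mulr_sumr -sumrB.
  under eq_bigr do rewrite mxE mulr_suml.
  rewrite exchange_big/=; apply: eq_bigr => i _.
  rewrite mulr_sumr -sumrB; apply: eq_bigr => j _.
  rewrite !mxE conjCK rmorphM; ring.
rewrite (_ : \sum_i _ =
    combination (fun i => c i * phi (p i)) p (rkhs_eval f)); last first.
  by apply: eq_bigr => i _; rewrite mulrA.
rewrite -dw; apply: le_trans (cauchy_schwarz _ _) _.
rewrite mulrC -!mulrA [hnorm f * b]mulrC !mulrA ler_wpM2r ?hnorm_ge0//.
by apply: le_trans wu _; rewrite -mulrA ler_wpM2l.
Qed.

End Multiplier.

Theorem proposition2p3 (R : realType) (d : nat) (Omega : set (cspace R d))
  (Omega_open : open Omega)
  (H : rkhs Omega)
  (H_analytic : forall f : H, analytic_on Omega (rkhs_eval f))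
  (K : cspace R d -> cspace R d -> cplx R)
  (K_kernel : reproducing_kernel H K)
  (K_diag : forall z, Omega z -> K z z <> 0)
  (phi : cspace R d -> cplx R)
  (phi_fin : (mult_norm Omega K 3 phi < +oo)%E) :
  analytic_on Omega phi.
Proof.
move=> a Oa.
have [_ [C [C0 pos] _] _] := ereal_inf_lt phi_fin.
have /nbhs_polydiscP[s0 s00 aO] : nbhs a Omega.
  exact: open_nbhs_nbhs.
have [s /andP[sgt0 ss0] [M M0 tM]] := tame_uniform s00 aO
  (fun f => analytic_tame (H_analytic f a Oa)).
have [ka [kaE _]] := K_kernel a Oa.
have aO' : polydisc a s `<=` Omega by exact: subset_trans (polydiscS ss0) aO.
have psi := tame_multiplier K_kernel sgt0 aO' M0 C0 tM pos ka.
have [|t /andP[t0 ts] [k0 [N kV]]] := tameV sgt0 (tM ka).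
  by rewrite kaE//; apply/eqP; exact: K_diag.
apply: (tame_analytic t0).
apply: (eq_tame _ (tameM t0 (tame_mono t0 ts (lexx _) psi) kV)) => x.
by rewrite inE => /k0 kx; rewrite mulfK.
Qed.
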